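(* Let $f:\mathbb A\to\mathbb A$ be an exact symplectic homeomorphism. Assume that $f$ preserves each leaf of a foliation $\mathcal F$ into $C^0$ graphs which is symplectically homeomorphic, by a symplectic homeomorphism $\Phi:\mathbb A\to\mathbb A$, to the standard foliation $\mathcal F_0=\Phi(\mathcal F)$. Then there exists a continuous function $\rho:\mathbb R\to\mathbb R$ such that $$\forall(\theta,r)\in\mathbb A,\quad\Phi\circ f\circ\Phi^{-1}(\theta,r)=(\theta+\rho(r),r).$$
   Context: $\mathbb T=\mathbb R/\mathbb Z$, $\mathbb A=\mathbb T\times\mathbb R$ with coordinates $(\theta,r)$, endowed with the standard symplectic (area) form. A symplectic homeomorphism is a homeomorphism that is locally a $C^0$ uniform limit of symplectic diffeomorphisms. A diffeomorphism $g:\mathbb A\to\mathbb A$ is exact symplectic if it is homotopic to the identity and the 1-form $g^*(r\,d\theta)-r\,d\theta$ is exact; an exact symplectic homeomorphism is a homeomorphism that is locally a $C^0$ uniform limit of exact symplectic diffeomorphisms. The standard foliation $\mathcal F_0$ is the foliation of $\mathbb A$ into the circles $\mathbb T\times\{c\}$, $c\in\mathbb R$. A foliation into $C^0$ graphs is the family of graphs of $\eta_a\in C^0(\mathbb T,\mathbb R)$, $a\in\mathbb R$, where $(\theta,a)\mapsto(\theta,\eta_a(\theta))$ is a homeomorphism of $\mathbb A$. *)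

(* Defs.v *)
From HB Require Import structures.
From mathcomp Require Import all_boot all_order all_algebra.
From mathcomp Require Import all_classical all_reals all_analysis.

Set Implicit Arguments.
Unset Strict Implicit.
Unset Printing Implicit Defensive.

Import Order.TTheory GRing.Theory Num.Theory.
Import numFieldNormedType.Exports.

Local Open Scope classical_set_scope.
Local Open Scope ring_scope.
Local Open Scope quotient_scope.

(* The predicate underlying Num.int; it carries the canonical structure of
   additive subgroup that Quotient.quot needs. *)
Definition integers (R : realType) : zmodClosed R :=
  GRing.ZmodClosed.clone R (@Num.int_num_subdef R) _.

(* R / Z, with the quotient group structure and the quotient topology. *)
Definition circle (R : realType) : Type :=
  quotient_topology (Quotient.quot (integers R)).

HB.instance Definition _ (R : realType) := Topological.on (circle R).
HB.instance Definition _ (R : realType) := Quotient.on (circle R).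
HB.instance Definition _ (R : realType) :=
  GRing.Zmodule.copy (circle R) (Quotient.quot (integers R)).

Definition annulus (R : realType) : Type := (circle R * R)%type.

HB.instance Definition _ (R : realType) := Topological.on (annulus R).
HB.instance Definition _ (R : realType) := GRing.Zmodule.on (annulus R).

Definition angle (R : realType) (x : R) : circle R := \pi_(circle R) x.

Definition annulus_pi (R : realType) (p : R * R) : annulus R :=
  (angle p.1, p.2).

Definition homeomorphism (X Y : topologicalType) (f : X -> Y) : Prop :=
  continuous f /\
  exists g : Y -> X, [/\ cancel f g, cancel g f & continuous g].

(* Derivatives and differential forms are written in the universal cover R * R:
   by simple connectedness, a map of the annulus is C1 iff it has a C1 lift, and
   two such lifts differ by an integer translation of the first coordinate. *)
Definition C1 (R : realType) (V W : normedModType R) (F : V -> W) : Prop :=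
  (forall p, differentiable F p) /\ forall v, continuous (fun p => 'D_v F p).

Definition lifts (R : realType) (G : R * R -> R * R)
    (g : annulus R -> annulus R) : Prop :=
  forall p, annulus_pi (G p) = g (annulus_pi p).

Definition annulus_C1 (R : realType) (g : annulus R -> annulus R) : Prop :=
  exists G : R * R -> R * R, lifts G g /\ C1 G.

Definition diffeomorphism (R : realType) (g : annulus R -> annulus R) : Prop :=
  annulus_C1 g /\
  exists h : annulus R -> annulus R,
    [/\ cancel g h, cancel h g & annulus_C1 h].

(* d theta /\ dr, whose coefficients are constant. *)
Definition area_form (R : realType) (u v : R * R) : R :=
  u.1 * v.2 - u.2 * v.1.

Definition symplectic_diffeomorphism (R : realType)
    (g : annulus R -> annulus R) : Prop :=
  diffeomorphism g /\
  forall G : R * R -> R * R, lifts G g -> C1 G ->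
  forall p u v : R * R,
    area_form ('D_u G p) ('D_v G p) = area_form u v.

(* The 1-form r d theta. *)
Definition liouville (R : realType) (p v : R * R) : R := p.2 * v.1.

Definition homotopic_to_id (X : topologicalType) (R : realType)
    (g : X -> X) : Prop :=
  exists H : R * X -> X,
    [/\ {within `[0, 1]%classic `*` [set: X], continuous H},
        forall p, H (0, p) = p &
        forall p, H (1, p) = g p].

(* The primitive S lives on the annulus, not only on its universal cover. *)
Definition exact_symplectic_diffeomorphism (R : realType)
    (g : annulus R -> annulus R) : Prop :=
  [/\ diffeomorphism g,
      homotopic_to_id R g &
      forall G : R * R -> R * R, lifts G g -> C1 G ->
      exists S : annulus R -> R,
        C1 (S \o @annulus_pi R) /\
        forall p v : R * R,
          'D_v (S \o @annulus_pi R) p =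
          liouville (G p) ('D_v G p) - liouville p v].

(* The convergence of g_n to f is uniform, for the translation-invariant uniform
   structure of the topological group (R / Z) * R, near every point. *)
Definition locally_uniform_limit (R : realType)
    (P : (annulus R -> annulus R) -> Prop) (f : annulus R -> annulus R) : Prop :=
  exists g : nat -> annulus R -> annulus R,
    (forall n, P (g n)) /\
    forall p : annulus R, exists U : set (annulus R), nbhs p U /\
      forall W : set (annulus R), nbhs (0 : annulus R) W ->
        \forall n \near \oo, forall q, U q -> W (g n q - f q).

Definition symplectic_homeomorphism (R : realType)
    (f : annulus R -> annulus R) : Prop :=
  homeomorphism f /\ locally_uniform_limit (@symplectic_diffeomorphism R) f.

Definition exact_symplectic_homeomorphism (R : realType)
    (f : annulus R -> annulus R) : Prop :=
  homeomorphism f /\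
  locally_uniform_limit (@exact_symplectic_diffeomorphism R) f.

(* A foliation is given by the family of its leaves. *)
Definition standard_foliation (R : realType) : set (set (annulus R)) :=
  [set [set p | p.2 = c] | c in [set: R]].
Arguments standard_foliation R : clear implicits.

Definition graph_leaf (R : realType) (eta : circle R -> R) : set (annulus R) :=
  [set p | p.2 = eta p.1].

Definition C0_graph_foliation (R : realType)
    (F : set (set (annulus R))) : Prop :=
  exists eta : R -> circle R -> R,
    [/\ forall a, continuous (eta a),
        homeomorphism
          (fun p : annulus R => (p.1, eta p.2 p.1) : annulus R) &
        F = [set graph_leaf (eta a) | a in [set: R]]].

(* Main.v *)
(* In the coordinates given by [Phi] the map [g = Phi f Phi^-1] preserves every
   horizontal circle, and it preserves area, because area preservation passes to
   C^0 limits. If [x -> X(x, r)] lifts [g] on the circle of height [r], then [g]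
   maps a thin rectangle [[a, b] x [r, r + h]] onto a set containing a rectangle
   of width almost [X(b, r) - X(a, r)] and height [h], so
   [X(b, r) - X(a, r) <= b - a] for [a <= b]. Exactness (through the homotopy to
   the identity) gives [X(x + 1, r) = X(x, r) + 1], and the same inequality on
   the complementary arc turns it into an equality: [X(x, r) = x + X(0, r)].

   Only an inequality between areas is needed, so area is measured by the outer
   Jordan content in the universal cover. A map with [det = 1] does not increase
   it by bisection: near a point the map is its differential up to a relatively
   small error, and a matrix of determinant 1 is a product of shears. *)

Require Import Defs.
From mathcomp Require Import all_boot all_order all_algebra.
From mathcomp Require Import all_classical all_reals all_analysis.
From mathcomp Require Import ring lra.

Set Implicit Arguments.
Unset Strict Implicit.
Unset Printing Implicit Defensive.

Import Order.TTheory GRing.Theory Num.Theory numFieldNormedType.Exports.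
Local Open Scope classical_set_scope.
Local Open Scope ring_scope.

(** * Bisection of rectangles *)

(** The approximations of [f] and of [Phi] are never conjugated: the lifts of [f], [Phi] and
    [Phi^-1] are each shown not to increase content, and only these limits are composed. The
    obstacle is the passage to the limit. When [G] is uniformly close to [F], the set [F(Q)] must be
    covered by the [G]-image of a slightly larger rectangle, and closeness alone does not give this;
    approximating maps are therefore carried along with their inverses. The determinant of an exact
    diffeomorphism is not immediate either: the map is only C1, so the equation satisfied by its
    primitive cannot be differentiated, and a pointwise form of the symmetry of second derivatives
    is used instead. Each passage from a neighbourhood of every point to a whole rectangle is an
    instance of one bisection principle. *)

Definition rect (R : realType) (x y w h : R) : set (R * R) :=
  [set p | (x <= p.1 <= x + w) && (y <= p.2 <= y + h)].

Lemma nested_intervals (R : realType) (a b : R ^nat) :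
  (forall n, a n <= a n.+1) -> (forall n, b n.+1 <= b n) ->
  (forall n, a n <= b n) -> exists c, forall n, a n <= c <= b n.
Proof.
move=> a_incr b_decr ab.
have aM : {homo a : n m / (n <= m)%N >-> n <= m} by exact/nondecreasing_seqP.
have bM : {homo b : n m / (n <= m)%N >-> m <= n} by exact/nonincreasing_seqP.
have aUb n m : a n <= b m.
  case/orP: (leq_total n m) => nm.
    exact: le_trans (aM _ _ nm) (ab m).
  exact: le_trans (ab n) (bM _ _ nm).
exists (sup (range a)) => n; apply/andP; split.
  apply: ub_le_sup; last by exists n.
  by exists (b 0%N) => _ [m _ <-].
by apply: ge_sup => [|_ [m _ <-]//]; exists (a 0%N); exists 0%N.
Qed.

(** Compactness in the form of an induction: a counterexample halved forever shrinks to a point,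
    where the local hypothesis applies. Only the scale [t] is halved and the shape [w], [h] stays
    fixed, so degenerate rectangles are included. *)
Lemma rect_bisection (R : realType) (w h : R) (P : R -> R -> R -> Prop) :
  0 <= w -> 0 <= h ->
  (forall x y t, 0 < t ->
    P x y (t / 2) -> P (x + t / 2 * w) y (t / 2) ->
    P x (y + t / 2 * h) (t / 2) -> P (x + t / 2 * w) (y + t / 2 * h) (t / 2) ->
    P x y t) ->
  (forall p : R * R, exists2 d : R, 0 < d &
    forall x y t, 0 < t < d -> rect x y (t * w) (t * h) p -> P x y t) ->
  forall x y t, 0 < t -> P x y t.
Proof.
move=> w0 h0 split4 loc x0 y0 t0 t0_gt0; apply: contrapT => nP0.
(* The conditions on [s] stand inside the existential so that [choice] yields a total function. *)
have next (s : R * R * R) : exists s' : R * R * R,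
    0 < s.2 -> ~ P s.1.1 s.1.2 s.2 ->
    [/\ ~ P s'.1.1 s'.1.2 s'.2, s'.2 = s.2 / 2,
      s.1.1 <= s'.1.1 /\ s'.1.1 + s'.2 * w <= s.1.1 + s.2 * w &
      s.1.2 <= s'.1.2 /\ s'.1.2 + s'.2 * h <= s.1.2 + s.2 * h].
  case: s => [[x y] t] /=.
  have [t_gt0|] := boolP (0 < t); last by exists (x, y, t).
  have tw : 0 <= t / 2 * w by rewrite mulr_ge0// divr_ge0// ltW.
  have th : 0 <= t / 2 * h by rewrite mulr_ge0// divr_ge0// ltW.
  have ew : t * w = t / 2 * w + t / 2 * w by field.
  have eh : t * h = t / 2 * h + t / 2 * h by field.
  apply: contrapT => nex.
  have nex4 x' y' : x <= x' -> x' + t / 2 * w <= x + t * w ->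
     y <= y' -> y' + t / 2 * h <= y + t * h -> P x' y' (t / 2).
    move=> ? ? ? ?; apply: contrapT => nP'; apply: nex.
    by exists (x', y', t / 2).
  apply: nex; exists (x, y, t) => _ []; apply: split4 => //; apply: nex4;
  by rewrite ?ew ?eh; lra.
have [f fP] := choice next.
pose u n := iter n f (x0, y0, t0).
have u_inv n : (u n).2 = t0 / 2 ^+ n /\ ~ P (u n).1.1 (u n).1.2 (u n).2.
  elim: n => [|n [t_n nPn]]; first by rewrite expr0 divr1.
  have [|//|? e _ _] := fP (u n).
    by rewrite t_n divr_gt0// exprn_gt0.
  by split => //=; rewrite e t_n exprS; field; rewrite expf_neq0//.
have un_gt0 n : 0 < (u n).2.
  by have [-> _] := u_inv n; rewrite divr_gt0// exprn_gt0.
have step n : _ := fP (u n) (un_gt0 n) (u_inv n).2.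
have [|||px pxP] :=
    @nested_intervals R (fun n => (u n).1.1)
      (fun n => (u n).1.1 + (u n).2 * w).
- by move=> n; have [_ _ []] := step n.
- by move=> n; have [_ _ []] := step n.
- by move=> n; rewrite lerDl mulr_ge0// ltW.
have [|||py pyP] :=
    @nested_intervals R (fun n => (u n).1.2)
      (fun n => (u n).1.2 + (u n).2 * h).
- by move=> n; have [_ _ _ []] := step n.
- by move=> n; have [_ _ _ []] := step n.
- by move=> n; rewrite lerDl mulr_ge0// ltW.
have [d d_gt0 dP] := loc (px, py).
have [n t_n] : exists n, (u n).2 < d.
  (* For this [n], [t0 / d < n <= 2 ^ n]. *)
  exists (Num.truncn (t0 / d)).+1; rewrite (u_inv _).1.
  rewrite ltr_pdivrMr ?exprn_gt0// mulrC -ltr_pdivrMr//.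
  apply: lt_le_trans (truncnS_gt _) _.
  by rewrite -natrX ler_nat ltnW// ltn_expl.
apply: (u_inv n).2; apply: dP; first by rewrite un_gt0.
by rewrite /rect/= pxP pyP.
Qed.

(** * The circle and the annulus *)

Definition sup_close (R : realType) (e : R) (p q : R * R) : Prop :=
  `|q.1 - p.1| < e /\ `|q.2 - p.2| < e.

Lemma nbhs_sup_closeP (R : realType) (p : R * R) (U : set (R * R)) :
  nbhs p U <-> exists2 e : R, 0 < e & forall q, sup_close e p q -> U q.
Proof.
split=> [/nbhs_ballP[e/= e_gt0 eU]|[e e_gt0 eU]].
  by exists e => // q [q1 q2]; apply: eU; split; rewrite /ball/= distrC.
apply/nbhs_ballP; exists e => //= q [q1 q2]; apply: eU.
by split; rewrite distrC.
Qed.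

Lemma continuous_sup_closeP (R : realType) (F : R * R -> R * R) :
  continuous F <-> forall p e, 0 < e ->
    exists2 d : R, 0 < d & forall q, sup_close d p q -> sup_close e (F p) (F q).
Proof.
split=> [cF p e e_gt0|cF p U /nbhs_sup_closeP[e e_gt0 eU]].
  by apply/nbhs_sup_closeP; apply: cF; apply/nbhs_sup_closeP; exists e.
apply/nbhs_sup_closeP; have [d d_gt0 dF] := cF p e e_gt0.
by exists d => // q /dF /eU.
Qed.

Lemma angle_eq (R : realType) (x y : R) :
  angle x = angle y <-> x - y \is a Num.int.
Proof.
have -> : (x - y \is a Num.int) = (x - y \in integers R) by [].
rewrite (Quotient.idealrBE (integers R) x y).
by split=> [e|/eqP e]; [apply/eqP; exact: e|exact: e].
Qed.

Lemma angleD (R : realType) (x y : R) : angle (x + y) = angle x + angle y.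
Proof. exact: Quotient.pi_add. Qed.

Lemma angleN (R : realType) (x : R) : angle (- x) = - angle x.
Proof. exact: Quotient.pi_opp. Qed.

Lemma angleDint (R : realType) (x k : R) :
  k \is a Num.int -> angle (x + k) = angle x.
Proof. by move=> kZ; apply/angle_eq; rewrite addrC addKr. Qed.

Lemma angle_surj (R : realType) (z : circle R) : exists x, angle x = z.
Proof. by exists (repr z); exact: reprK. Qed.

Lemma angle_continuous (R : realType) : continuous (@angle R).
Proof. exact: pi_continuous. Qed.

(** The saturation of [U] is the union of its integer translates. *)
Lemma angle_open (R : realType) (U : set R) : open U -> open (@angle R @` U).
Proof.
move=> Uo; rewrite /open/= /quotient_open.
rewrite [X in open X](_ : _ = \bigcup_(k in [set k : R | k \is a Num.int])
    ((fun x => x + k) @^-1` U)).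
  apply: bigcup_open => k _; apply: open_comp => // x _.
  by apply: continuousD; [exact: cvg_id|exact: cvg_cst].
apply/seteqP; split=> [x [y Uy] /angle_eq yx|x [k kZ Uxk]].
  by exists (y - x) => //=; rewrite addrC subrK.
by exists (x + k) => //; exact: angleDint.
Qed.

Lemma nbhs_angle (R : realType) (x : R) (U : set R) :
  nbhs x U -> nbhs (angle x) (@angle R @` U).
Proof.
move=> xU; apply: (@filterS _ _ _ (@angle R @` U^°)).
  by move=> _ [y Uy <-]; exists y => //; exact: nbhs_singleton.
apply: open_nbhs_nbhs; split; first by apply: angle_open; exact: open_interior.
by exists x.
Qed.

Lemma annulus_pi_continuous (R : realType) : continuous (@annulus_pi R).
Proof.
move=> p U [[A B] [/= pA pB] ABU].
exists (@angle R @^-1` A, B) => [|q [/= qA qB]]; last exact: ABU.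
by split => //=; exact: (@angle_continuous R p.1).
Qed.

Lemma nbhs_annulus_pi (R : realType) (p : R * R) (U : set (R * R)) :
  nbhs p U -> nbhs (annulus_pi p) (@annulus_pi R @` U).
Proof.
case: p => x y [[A B] [/= /nbhs_angle xA yB] ABU].
exists (@angle R @` A, B) => //= -[_ r] /= [[a Aa <-] Br].
by exists (a, r) => //; apply: ABU.
Qed.

Lemma annulus_pi_eq (R : realType) (p q : R * R) :
  annulus_pi p = annulus_pi q <-> p.1 - q.1 \is a Num.int /\ p.2 = q.2.
Proof.
split=> [[/angle_eq]//|[/angle_eq pq1 pq2]].
by rewrite /annulus_pi pq1 pq2.
Qed.

(** * Lifting maps from the plane to the circle *)

Lemma continuous_pair (T U V : topologicalType) (f : T -> U) (g : T -> V) :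
  continuous f -> continuous g -> continuous (fun x => (f x, g x)).
Proof.
move=> cf cg x W [[A B] [/= fA gB] ABW].
have fgx : nbhs x (f @^-1` A `&` g @^-1` B).
  by apply: filterI; [exact: cf|exact: cg].
by apply: filterS fgx => z [/= Afz Bgz]; apply: ABW.
Qed.

Lemma continuous_after (T U V : topologicalType) (f : T -> U) (g : U -> V) :
  continuous f -> continuous g -> continuous (g \o f).
Proof. by move=> cf cg x; apply: continuous_comp; [exact: cf|exact: cg]. Qed.

Lemma continuous_fst (T U : topologicalType) : continuous (@fst T U).
Proof. by move=> p; exact: cvg_fst. Qed.

Lemma continuous_snd (T U : topologicalType) : continuous (@snd T U).
Proof. by move=> p; exact: cvg_snd. Qed.

Lemma nonexpansive_continuous (R : realType) (f : R -> R) :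
  (forall x y, `|f x - f y| <= `|x - y|) -> continuous f.
Proof.
move=> fl x; apply/cvgrPdist_lt => e e_gt0; apply/nbhs_ballP.
by exists e => //= y xy; apply: le_lt_trans (fl x y) _.
Qed.

Definition seg (R : realType) (p q : R * R) (t : R) : R * R :=
  (p.1 + t * (q.1 - p.1), p.2 + t * (q.2 - p.2)).

Lemma seg_continuous (R : realType) (p q : R * R) : continuous (seg p q).
Proof.
apply: continuous_pair => t.
  by apply: cvgD; [exact: cvg_cst|apply: cvgM; [exact: cvg_id|exact: cvg_cst]].
by apply: cvgD; [exact: cvg_cst|apply: cvgM; [exact: cvg_id|exact: cvg_cst]].
Qed.

Lemma seg0 (R : realType) (p q : R * R) : seg p q 0 = p.
Proof. by case: p => x y; rewrite /seg !mul0r !addr0. Qed.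

Lemma seg1 (R : realType) (p q : R * R) : seg p q 1 = q.
Proof. by case: p q => x y [z w]; rewrite /seg/=; congr pair; ring. Qed.

(** The nearest integer cannot change along a segment: otherwise [u] would take there a half-integer
    value, which is at distance at least 1/2 from every integer. *)
Lemma int_near_segment (R : realType) (u : R * R -> R) (p q : R * R)
    (k0 k1 : R) :
  continuous u ->
  (forall t, 0 <= t <= 1 ->
     exists2 k, k \is a Num.int & `|u (seg p q t) - k| < 1 / 2) ->
  k0 \is a Num.int -> k1 \is a Num.int ->
  `|u p - k0| < 1 / 2 -> `|u q - k1| < 1 / 2 -> k0 = k1.
Proof.
move=> cu near_int k0Z k1Z; wlog k01 : u k0 k1 cu near_int k0Z k1Z / k0 < k1.
  move=> H up uq; have [lt01|lt10|//] := ltgtP k0 k1; first exact: (H u).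
  apply: oppr_inj; apply: (H (fun z => - u z)).
  - by move=> z; apply: cvgN; exact: cu.
  - move=> t /near_int[k kZ ku]; exists (- k); first by rewrite rpredN.
    by rewrite -opprD normrN.
  - by rewrite rpredN.
  - by rewrite rpredN.
  - by rewrite ltrN2.
  - by rewrite -opprD normrN.
  - by rewrite -opprD normrN.
have gap (a b : R) : a \is a Num.int -> b \is a Num.int -> a < b -> a + 1 <= b.
  move=> aZ bZ ab; have ba : 0 < b - a by rewrite subr_gt0.
  rewrite -lerBrDl -(gtr0_norm ba).
  apply: norm_intr_ge1; last by rewrite gt_eqF.
  exact: rpredB.
have {}k01 := gap _ _ k0Z k1Z k01.
rewrite !ltr_norml => up uq.
have [|||c] := @IVT R (u \o seg p q) 0 1 (k0 + 1 / 2).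
- exact: ler01.
- apply: continuous_subspaceT => t.
  by apply: continuous_comp; [exact: seg_continuous|exact: cu].
- by rewrite /= seg0 seg1 ge_min le_max; apply/andP; split; apply/orP; lra.
rewrite in_itv/= => /near_int[k kZ] /[swap] ->.
rewrite ltr_norml => ck.
have [/(gap _ _ kZ k0Z)|/(gap _ _ k0Z kZ)|e] := ltgtP k k0; lra.
Qed.

Lemma int_valued_constant (R : realType) (u : R * R -> R) :
  continuous u -> (forall p, u p \is a Num.int) -> forall p q, u p = u q.
Proof.
move=> cu uZ p q; apply: (@int_near_segment R u p q) => //.
- by move=> t _; exists (u (seg p q t)); rewrite // subrr normr0; lra.
- by rewrite subrr normr0; lra.
- by rewrite subrr normr0; lra.
Qed.

(** [U] is continuous on the whole plane and not just on [D]: local lifts are extended by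
    retractions, which avoids subspace topologies. *)
Definition lift_on (R : realType) (u : R * R -> circle R) (D : set (R * R))
    (U : R * R -> R) : Prop :=
  continuous U /\ forall p, D p -> angle (U p) = u p.

(* On the overlap [U1] and [U2] differ by integers, which [angle] ignores, so
   they need not be made to agree. *)
Lemma lift_glue (R : realType) (u : R * R -> circle R) (D1 D2 : set (R * R))
    (r1 r2 s : R * R -> R * R) (U1 U2 : R * R -> R) :
  continuous r1 -> continuous r2 -> continuous s ->
  (forall p, D1 p -> r1 p = p /\ r2 p = s p) ->
  (forall p, D2 p -> [/\ r2 p = p, r1 p = s p, D1 (s p) & D2 (s p)]) ->
  lift_on u D1 U1 -> lift_on u D2 U2 ->
  exists2 U, lift_on u (D1 `|` D2) U & forall p, D1 p -> U p = U1 p.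
Proof.
move=> cr1 cr2 cs rD1 rD2 [cU1 U1u] [cU2 U2u].
(* The maps [r1] and [r2] act as retractions onto the two pieces and [s] as one onto their overlap.
   The glued function is [U1] on [D1], and on [D2] it is [U2 p] plus the integer
   [U1 (s p) - U2 (s p)]. *)
have UD1 p : D1 p -> U1 (r1 p) + U2 (r2 p) - U2 (s p) = U1 p.
  by move=> /rD1[-> ->]; rewrite addrK.
exists (fun p => U1 (r1 p) + U2 (r2 p) - U2 (s p)) => //; split.
  move=> p; apply: cvgB; last by apply: continuous_comp; [exact: cs|exact: cU2].
  apply: cvgD; first by apply: continuous_comp; [exact: cr1|exact: cU1].
  by apply: continuous_comp; [exact: cr2|exact: cU2].
move=> p []; first by move=> D1p; rewrite UD1 ?U1u.
move=> D2p; have [-> -> D1s D2s] := rD2 _ D2p.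
by rewrite !angleD angleN U1u// U2u// U2u// addrC addrA addNr add0r.
Qed.

Lemma continuous_minl (R : realType) (a : R) :
  continuous (fun x : R => Num.min x a).
Proof.
apply: nonexpansive_continuous => x y.
rewrite !minEle ler_norml; have := ler_norm (x - y).
have := ler_norm (y - x); rewrite [`|y - x|]distrC.
by case: (leP x a); case: (leP y a) => *; apply/andP; split; lra.
Qed.

Lemma continuous_maxl (R : realType) (a : R) :
  continuous (fun x : R => Num.max x a).
Proof.
apply: nonexpansive_continuous => x y.
rewrite !maxEle ler_norml; have := ler_norm (x - y).
have := ler_norm (y - x); rewrite [`|y - x|]distrC.
by case: (leP x a); case: (leP y a) => *; apply/andP; split; lra.
Qed.

Lemma continuous_map_fst (R : realType) (f : R -> R) :
  continuous f -> continuous (fun p : R * R => (f p.1, p.2)).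
Proof.
move=> cf; apply: continuous_pair; last exact: continuous_snd.
exact: continuous_after (@continuous_fst _ _) cf.
Qed.

Lemma continuous_map_snd (R : realType) (f : R -> R) :
  continuous f -> continuous (fun p : R * R => (p.1, f p.2)).
Proof.
move=> cf; apply: continuous_pair; first exact: continuous_fst.
exact: continuous_after (@continuous_snd _ _) cf.
Qed.

Definition clamp (R : realType) (a b x : R) : R := Num.max (Num.min x b) a.

Lemma clamp_continuous (R : realType) (a b : R) : continuous (clamp a b).
Proof.
exact: continuous_after (@continuous_minl R b) (@continuous_maxl R a).
Qed.

Lemma clamp_itv (R : realType) (a b x : R) :
  a <= b -> a <= clamp a b x <= b.
Proof. by move=> ab; rewrite le_max lexx orbT ge_max ge_min lexx orbT ab. Qed.

Lemma clamp_id (R : realType) (a b x : R) : a <= x <= b -> clamp a b x = x.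
Proof. by case/andP=> ax xb; rewrite /clamp min_l// max_l. Qed.

Definition clamp2 (R : realType) (x y w h : R) (p : R * R) : R * R :=
  (clamp x (x + w) p.1, clamp y (y + h) p.2).

Lemma clamp2_continuous (R : realType) (x y w h : R) :
  continuous (clamp2 x y w h).
Proof.
apply: continuous_pair.
  exact: continuous_after (@continuous_fst _ _) (@clamp_continuous R _ _).
exact: continuous_after (@continuous_snd _ _) (@clamp_continuous R _ _).
Qed.

Lemma clamp2_rect (R : realType) (x y w h : R) (p : R * R) :
  0 <= w -> 0 <= h -> rect x y w h (clamp2 x y w h p).
Proof. by move=> w0 h0; apply/andP; split; rewrite clamp_itv// lerDl. Qed.

Lemma clamp2_id (R : realType) (x y w h : R) (p : R * R) :
  rect x y w h p -> clamp2 x y w h p = p.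
Proof. by case: p => a b /andP[/= ax bx]; rewrite /clamp2/= !clamp_id. Qed.

(** An open arc of length 1 carries a section of [angle], continuous because [angle] is open;
    clamping extends the resulting lift from the square to the plane. *)
Lemma lift_small (R : realType) (u : R * R -> circle R) (p : R * R) :
  continuous u -> exists2 d : R, 0 < d & forall x y t, 0 < t < d ->
    rect x y t t p -> exists U, lift_on u (rect x y t t) U.
Proof.
move=> cu; have [x0 x0p] := angle_surj (u p).
pose arc : set (circle R) := @angle R @` ball x0 (1 / 2).
have arc_lift q : exists v, arc (u q) -> angle v = u q /\ `|v - x0| < 1 / 2.
  (* Off the arc, [x0] is a default value. *)
  have [[v vx0 vq]|] := pselect (arc (u q)); last by exists x0.
  by exists v => _; split => //; rewrite distrC.
have [V VP] := choice arc_lift.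
have cV q : arc (u q) -> {for q, continuous V}.
  move=> uq; have [Vq Vqx0] := VP q uq.
  apply/cvgrPdist_lt => e e_gt0.
  have nB : nbhs (V q) (ball (V q) e `&` ball x0 (1 / 2)).
    apply: filterI; first exact: nbhsx_ballx.
    apply/nbhs_ballP; exists (1 / 2 - `|V q - x0|) => [|y].
      by rewrite /= subr_gt0.
    rewrite /ball/= => yVq.
    by have := ler_distD (V q) x0 y; rewrite [`|x0 - V q|]distrC; lra.
  have := nbhs_angle nB; rewrite Vq => /(cu q) near_q.
  apply: (@filterS _ (nbhs q) _ _ _ _ near_q) => q' [v [vq vx0] vq'].
  have [|Vq' Vq'x0] := VP q'; first by exists v.
  (* Both numbers lie within 1/2 of [x0] and differ by an integer. *)
  suff -> : V q' = v by [].
  move: vx0; rewrite /ball/= => vx0.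
  apply/eqP; rewrite -subr_eq0; apply: contraT => Vv0.
  have /norm_intr_ge1 : V q' - v \is a Num.int.
    by apply/angle_eq; rewrite Vq' vq'.
  move/(_ Vv0); have -> : V q' - v = (V q' - x0) + (x0 - v) by ring.
  by have := ler_normD (V q' - x0) (x0 - v); lra.
have /nbhs_sup_closeP[d d_gt0 dP] : nbhs p (u @^-1` arc).
  apply: cu; rewrite -x0p; apply: nbhs_angle.
  by apply: nbhsx_ballx; lra.
exists d => // x y t /andP[t_gt0 td] /andP[px py].
have rect_arc q : rect x y t t q -> arc (u q).
  move=> /andP[qx qy]; apply: dP.
  by split; rewrite ltr_norml; apply/andP; split; lra.
exists (V \o clamp2 x y t t); split.
  move=> q; apply: continuous_comp; first exact: clamp2_continuous.
  by apply/cV/rect_arc/clamp2_rect; exact: ltW.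
move=> q qD /=; rewrite clamp2_id//.
by have [] := VP q (rect_arc q qD).
Qed.

Lemma lift_square (R : realType) (u : R * R -> circle R) (x y t : R) :
  continuous u -> 0 < t -> exists U, lift_on u (rect x y t t) U.
Proof.
move=> cu; suff H : forall x y t, 0 < t ->
    exists U, lift_on u (rect x y (t * 1) (t * 1)) U.
  by move=> t_gt0; have := H x y t t_gt0; rewrite mulr1.
move=> {x y t}.
apply: (@rect_bisection R 1 1
  (fun x y t => exists U, lift_on u (rect x y (t * 1) (t * 1)) U))
  => // [x y t t_gt0|p]; last first.
  have [d d_gt0 dP] := lift_small p cu.
  by exists d => // x y t td; rewrite !mulr1; exact: dP.
rewrite !mulr1 => -[U1 U1P] [U2 U2P] [U3 U3P] [U4 U4P].
have glue_left_right y' V1 V2 : lift_on u (rect x y' (t / 2) (t / 2)) V1 ->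
    lift_on u (rect (x + t / 2) y' (t / 2) (t / 2)) V2 ->
    exists V, lift_on u (rect x y' t (t / 2)) V.
  (* [min] and [max] with the abscissa of the common edge retract onto the two half-planes, and
     fixing that abscissa retracts onto the edge. *)
  move=> V1P V2P; have := @lift_glue R u _ _
    (fun p => (Num.min p.1 (x + t / 2), p.2))
    (fun p => (Num.max p.1 (x + t / 2), p.2))
    (fun p => (x + t / 2, p.2)) V1 V2 _ _ _ _ _ V1P V2P.
  case.
  - exact: (continuous_map_fst (@continuous_minl R (x + t / 2))).
  - exact: (continuous_map_fst (@continuous_maxl R (x + t / 2))).
  - exact: (@continuous_map_fst R (cst (x + t / 2)) (@cst_continuous _ _ _)).
  - case=> a b /andP[/= /andP[xa ax] yb].
    by rewrite min_l// max_r.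
  - case=> a b /andP[/= /andP[xa ax] yb].
    rewrite max_l// min_r//; split => //; apply/andP; split => //=; lra.
  - move=> V VP _; exists V; case: VP => cV Vu; split => // p.
    move=> /andP[px py]; apply: Vu.
    have [pm|mp] := leP p.1 (x + t / 2); [left|right];
    by apply/andP; split => //; lra.
have [W1 W1P] := glue_left_right _ _ _ U1P U2P.
have [W2 W2P] := glue_left_right _ _ _ U3P U4P.
have := @lift_glue R u _ _
    (fun p => (p.1, Num.min p.2 (y + t / 2)))
    (fun p => (p.1, Num.max p.2 (y + t / 2)))
    (fun p => (p.1, y + t / 2)) W1 W2 _ _ _ _ _ W1P W2P.
case.
- exact: (continuous_map_snd (@continuous_minl R (y + t / 2))).
- exact: (continuous_map_snd (@continuous_maxl R (y + t / 2))).
- exact: (@continuous_map_snd R (cst (y + t / 2)) (@cst_continuous _ _ _)).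
- case=> a b /andP[/= xa /andP[yb bby]].
  by rewrite min_l// max_r.
- case=> a b /andP[/= xa /andP[yb bby]].
  rewrite max_l// min_r//; split => //; apply/andP; split => //=; lra.
- move=> V VP _; exists V; case: VP => cV Vu; split => // p.
  move=> /andP[px py]; apply: Vu.
  have [pm|mp] := leP p.2 (y + t / 2); [left|right];
  by apply/andP; split => //; lra.
Qed.

(** The squares [B n] exhaust the plane and each lift extends the previous one, so the value at [p]
    no longer changes once [B n] contains [p]. *)
Lemma lift_exists (R : realType) (u : R * R -> circle R) :
  continuous u ->
  exists U : R * R -> R, continuous U /\ forall p, angle (U p) = u p.
Proof.
move=> cu.
pose B (n : nat) : set (R * R) :=
  rect (- n.+1%:R) (- n.+1%:R) (n.+1%:R *+ 2) (n.+1%:R *+ 2).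
have w_ge0 n : 0 <= n.+1%:R *+ 2 :> R by rewrite mulrn_wge0.
have BS n : B n `<=` B n.+1.
  move=> p; rewrite /B /rect/= !mulr2n -[n.+2%:R]natr1 => /andP[] p1 p2.
  by apply/andP; split; lra.
have liftB n : exists U, lift_on u (B n) U.
  by apply: lift_square; rewrite // pmulrn_lgt0.
have extend n U : exists U', lift_on u (B n) U ->
    lift_on u (B n.+1) U' /\ forall p, B n p -> U' p = U p.
  have [UP|] := pselect (lift_on u (B n) U); last by exists U.
  have [U2 U2P] := liftB n.+1.
  pose c : R * R -> R * R :=
    clamp2 (- n.+1%:R) (- n.+1%:R) (n.+1%:R *+ 2) (n.+1%:R *+ 2).
  have := @lift_glue R u _ _ c id c U U2 _ _ _ _ _ UP U2P.
  case.
  - exact: clamp2_continuous.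
  - by move=> p; exact: cvg_id.
  - exact: clamp2_continuous.
  - by move=> p Bp; rewrite /c clamp2_id.
  - move=> p Bp; have Bcp : B n (c p) by exact: clamp2_rect.
    by split => //; exact: BS.
  - move=> V [cV Vu] VU; exists V => _; split => //; split => // p Bp.
    by apply: Vu; right.
have [E EP] := choice (fun nU : nat * (R * R -> R) => extend nU.1 nU.2).
have [U0 U0P] := liftB 0%N.
pose V := fix V n := if n is m.+1 then E (m, V m) else U0.
have VP n : lift_on u (B n) (V n).
  by elim: n => //= n IH; have [] := EP (n, V n) IH.
have VS n p : B n p -> V n.+1 p = V n p.
  by move=> Bp; have [_] := EP (n, V n) (VP n); exact.
have Ble n m : (n <= m)%N -> B n `<=` B m.
  by move=> /subnK <-; elim: (m - n)%N => // k IH p /IH; exact: BS.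
have Vle n m p : (n <= m)%N -> B n p -> V m p = V n p.
  move=> nm Bp; rewrite -(subnK nm); elim: (m - n)%N => // k <-.
  by rewrite addSn VS//; apply: Ble Bp; rewrite leq_addl.
pose N (p : R * R) := Num.truncn (`|p.1| + `|p.2|).
have BN p m : `|p.1| + `|p.2| <= m.+1%:R -> B m p.
  move=> pm; rewrite /B /rect/= !mulr2n.
  have := ler_norm p.1; have := ler_norm (- p.1); rewrite normrN.
  have := ler_norm p.2; have := ler_norm (- p.2); rewrite normrN.
  have := normr_ge0 p.1; have := normr_ge0 p.2.
  by move=> *; apply/andP; split; lra.
have BNp p : B (N p) p by apply: BN; rewrite ltW// truncnS_gt.
exists (fun p => V (N p) p); split; last first.
  by move=> p; have [_] := VP (N p); exact.
move=> p W pW.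
(* Within distance 1 of [p] each of the two absolute values grows by less than 1, hence the 2: [B m]
   contains this neighbourhood. *)
pose m := (N p + 2)%N.
have Vm q : B m q -> V (N q) q = V m q.
  move=> Bq; case/orP: (leq_total (N q) m) => Nqm.
    by rewrite (@Vle (N q) m).
  by rewrite (@Vle m (N q)).
have := (VP m).1 p W; rewrite -Vm; last by apply: Ble (BNp p); rewrite leq_addr.
move/(_ pW) => /nbhs_sup_closeP[d d_gt0 dW].
apply/nbhs_sup_closeP; exists (Num.min d 1).
  by rewrite lt_min d_gt0 ltr01.
move=> q [q1 q2]; move: q1 q2; rewrite !lt_min => /andP[q1d q1] /andP[q2d q2].
rewrite /= Vm; first exact: dW.
apply: BN.
have := truncnS_gt (`|p.1| + `|p.2|); rewrite -/(N p) => Np.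
have q1p := ler_normD p.1 (q.1 - p.1); have q2p := ler_normD p.2 (q.2 - p.2).
move: q1p q2p; rewrite ![_ + (_ - _)]addrC !subrK => q1p q2p.
rewrite /m addn2 -!natr1; rewrite -natr1 in Np; lra.
Qed.

(** * Outer Jordan content *)

(** A rectangle is encoded as its lower left corner followed by its two side lengths. *)
Definition seq_area (R : realType) (s : seq ((R * R) * (R * R))) : R :=
  \sum_(b <- s) b.2.1 * b.2.2.

Definition seq_cover (R : realType) (s : seq ((R * R) * (R * R))) :
    set (R * R) :=
  [set p | exists2 b, b \in s & rect b.1.1 b.1.2 b.2.1 b.2.2 p].

(** An upper bound for the outer Jordan content, with the infimum over finite covers unfolded; a set
    without a finite cover satisfies no such bound. *)
Definition content_le (R : realType) (E : set (R * R)) (c : R) : Prop :=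
  forall e, 0 < e -> exists s : seq ((R * R) * (R * R)),
    [/\ forall b, b \in s -> 0 <= b.2.1 /\ 0 <= b.2.2,
        E `<=` seq_cover s & seq_area s <= c + e].

Lemma content_leW (R : realType) (E E' : set (R * R)) (c c' : R) :
  E `<=` E' -> c' <= c -> content_le E' c' -> content_le E c.
Proof.
move=> EE' c'c E'c' e /E'c'[s [s0 sE' sc]]; exists s; split => //.
  exact: subset_trans sE'.
by apply: le_trans sc _; rewrite lerD2r.
Qed.

Lemma content_le_lim (R : realType) (E : set (R * R)) (c : R) :
  (forall e, 0 < e -> content_le E (c + e)) -> content_le E c.
Proof.
move=> Ec e e_gt0; have e2 : 0 < e / 2 by rewrite divr_gt0.
have [s [s0 sE sc]] := Ec _ e2 _ e2.
by exists s; split => //; apply: le_trans sc _; lra.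
Qed.

Lemma content_le0 (R : realType) : content_le (@set0 (R * R)) 0.
Proof.
move=> e e_gt0; exists [::]; split => //.
by rewrite /seq_area big_nil add0r ltW.
Qed.

Lemma content_leU (R : realType) (E E' : set (R * R)) (c c' : R) :
  content_le E c -> content_le E' c' -> content_le (E `|` E') (c + c').
Proof.
move=> Ec E'c' e e_gt0; have e2 : 0 < e / 2 by rewrite divr_gt0.
have [s [s0 sE sc]] := Ec _ e2; have [s' [s'0 s'E' s'c']] := E'c' _ e2.
exists (s ++ s'); split.
- by move=> b; rewrite mem_cat => /orP[/s0|/s'0].
- by move=> p [/sE|/s'E'] [b bs bp]; exists b; rewrite // mem_cat bs ?orbT.
- by rewrite /seq_area big_cat/=; rewrite /seq_area in sc s'c'; lra.
Qed.

Lemma content_le_rect (R : realType) (x y w h : R) :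
  0 <= w -> 0 <= h -> content_le (rect x y w h) (w * h).
Proof.
move=> w0 h0 e e_gt0; exists [:: ((x, y), (w, h))]; split.
- by move=> b; rewrite inE => /eqP ->.
- by move=> p pR; exists ((x, y), (w, h)); rewrite ?inE.
- by rewrite /seq_area big_seq1 lerDl ltW.
Qed.

(** The lower bound on content comes from the product Lebesgue measure, which is subadditive and
    gives rectangles their elementary area. *)
Lemma content_le_rect_le (R : realType) (x y w h c : R) :
  0 <= w -> 0 <= h -> content_le (rect x y w h) c -> w * h <= c.
Proof.
move=> w0 h0 Rc; apply/ler_addgt0Pr => e /Rc[s [s0 sR]]; apply: le_trans.
pose mu := (@lebesgue_measure R \x @lebesgue_measure R)%E.
have rectE (a b k l : R) :
    rect a b k l = `[a, a + k]%classic `*` `[b, b + l]%classic.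
  by apply/seteqP; split=> p /=; rewrite /rect/= !in_itv/= => /andP.
have m_rect (a b k l : R) :
    measurable (rect a b k l : set (measurableTypeR R * measurableTypeR R)).
  by rewrite rectE; apply: measurableX; exact: measurable_itv.
have itvE (a l : R) :
    0 <= l -> lebesgue_measure (`[a, a + l]%classic : set R) = l%:E.
  move=> l0; rewrite lebesgue_measure_itv/= lte_fin ltrDl.
  have [l_gt0|l_le0] := ltP 0 l; first by rewrite -EFinD addrC addKr.
  by congr EFin; apply/le_anti; rewrite l0.
have mu_rect (a b k l : R) :
    0 <= k -> 0 <= l -> mu (rect a b k l) = (k * l)%:E.
  move=> k0 l0; rewrite rectE /mu product_measure1E; try exact: measurable_itv.
  by rewrite EFinM; congr (_ * _)%E; exact: itvE.
rewrite -lee_fin -(mu_rect x y)//.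
pose b0 : (R * R) * (R * R) := ((0, 0), (0, 0)).
pose F k := rect (nth b0 s k).1.1 (nth b0 s k).1.2
  (nth b0 s k).2.1 (nth b0 s k).2.2.
have /= sub := @content_subadditive _ _ _ mu (rect x y w h) F (size s).
apply: le_trans (sub (fun k _ => m_rect _ _ _ _) (m_rect _ _ _ _) _) _.
  move=> p /sR[b bs bp]; rewrite -bigcup_mkord; exists (index b s) => /=.
    by rewrite index_mem.
  by rewrite /F nth_index.
rewrite /seq_area (big_nth b0) big_mkord -sumEFin.
apply: lee_sum => i _; have [k0 l0] := s0 _ (mem_nth b0 (ltn_ord i)).
by rewrite [leLHS](mu_rect _ _ _ _ k0 l0).
Qed.

(** Tested on rectangles only; [contracting_content] extends it to all sets, which makes it stable
    under composition. *)
Definition contracting (R : realType) (G : R * R -> R * R) : Prop :=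
  forall x y w h, 0 <= w -> 0 <= h -> content_le (G @` rect x y w h) (w * h).

Lemma contracting_content (R : realType) (G : R * R -> R * R)
    (E : set (R * R)) (c : R) :
  contracting G -> content_le E c -> content_le (G @` E) c.
Proof.
move=> Gc Ec; apply: content_le_lim => e /Ec[s [s0 sE sc]].
apply: (@content_leW _ _ (G @` seq_cover s) _ (seq_area s)) => //.
  exact: image_subset.
elim: s s0 {sE sc} => [_|b s IH s0].
  rewrite /seq_area big_nil; apply: content_leW (@content_le0 R) => //.
  by move=> q [p [b]].
rewrite /seq_area big_cons.
have [w0 h0] := s0 b (mem_head _ _).
apply: content_leW (content_leU (Gc b.1.1 b.1.2 _ _ w0 h0) (IH _)) => //.
  move=> _ [p [b' + bp] <-]; rewrite inE => /predU1P[b'b|b's].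
    by left; exists p; rewrite -?b'b.
  by right; exists p => //; exists b'.
by move=> b' b's; apply: s0; rewrite inE b's orbT.
Qed.

Lemma contracting_comp (R : realType) (F G : R * R -> R * R) :
  contracting F -> contracting G -> contracting (F \o G).
Proof.
move=> cF cG x y w h w0 h0; rewrite -image_comp.
by apply: contracting_content => //; exact: cG.
Qed.

Lemma contracting_translation (R : realType) (v : R * R) :
  contracting (fun p => p + v).
Proof.
move=> x y w h w0 h0.
apply: content_leW (@content_le_rect R (x + v.1) (y + v.2) w h w0 h0) => //.
by move=> _ [p /andP[px py] <-]; apply/andP; split => /=; lra.
Qed.

Definition swap (R : realType) (p : R * R) : R * R := (p.2, p.1).

Lemma contracting_swap (R : realType) : contracting (@swap R).
Proof.
move=> x y w h w0 h0; rewrite mulrC.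
apply: content_leW (@content_le_rect R y x h w h0 w0) => //.
by move=> _ [p /andP[px py] <-]; apply/andP.
Qed.

Definition shear (R : realType) (k : R) (p : R * R) : R * R :=
  (p.1 + k * p.2, p.2).

(** Each sheared strip of height [h] fits in a rectangle of width [w + |k| h]. *)
Lemma content_le_shear_strips (R : realType) (k x y w h : R) (n : nat) :
  0 <= w -> 0 <= h ->
  content_le (shear k @` rect x y w (n.+1%:R * h))
    (n.+1%:R * ((w + `|k| * h) * h)).
Proof.
move=> w0 h0; have kh0 : 0 <= `|k| * h by rewrite mulr_ge0.
have strip z : content_le (shear k @` rect x z w h) ((w + `|k| * h) * h).
  have wkh : 0 <= w + `|k| * h by rewrite addr_ge0.
  (* The offset of the leftmost point of the sheared strip, which depends on the sign of [k]. *)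
  pose a : R := Num.min 0 (k * h).
  apply: content_leW (@content_le_rect R (x + k * z + a) z _ _ wkh h0) => //.
  move=> _ [p /andP[px pz] <-]; apply/andP; split => //=.
  have pz0 : 0 <= p.2 - z <= h by apply/andP; split; lra.
  have -> : k * p.2 = k * z + k * (p.2 - z) by ring.
  rewrite /a; have [k0|k0] := ltP k 0.
    rewrite (ltr0_norm k0) min_r; last by rewrite nmulr_rle0.
    have : k * h <= k * (p.2 - z) by rewrite ler_nM2l//; lra.
    have : k * (p.2 - z) <= 0 by rewrite nmulr_rle0//; lra.
    by rewrite mulNr => *; apply/andP; split; lra.
  rewrite (ger0_norm k0) min_l; last by rewrite mulr_ge0.
  have : k * (p.2 - z) <= k * h by rewrite ler_wpM2l//; lra.
  have : 0 <= k * (p.2 - z) by rewrite mulr_ge0//; lra.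
  by move=> *; apply/andP; split; lra.
elim: n => [|n IH]; first by rewrite !mul1r; exact: strip.
rewrite -natr1 [(_ + 1) * h]mulrDl [(_ + 1) * (_ * h)]mulrDl !mul1r.
apply: content_leW (content_leU IH (strip (y + n.+1%:R * h))) => //.
move=> _ [p /andP[px py] <-].
  have [pn|pn] := leP p.2 (y + n.+1%:R * h); [left|right]; exists p => //;
by apply/andP; split => //; lra.
Qed.

(** Cutting the rectangle into [n + 1] horizontal strips leaves an excess of [|k| h ^ 2 / (n + 1)],
    which tends to 0. *)
Lemma contracting_shear (R : realType) (k : R) : contracting (shear k).
Proof.
move=> x y w h w0 h0; apply: content_le_lim => e e_gt0.
pose n := Num.truncn (`|k| * h ^+ 2 / e).
have n0 : 0 < n.+1%:R :> R by rewrite ltr0n.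
have -> : h = n.+1%:R * (h / n.+1%:R) by field; rewrite gt_eqF.
have hn0 : 0 <= h / n.+1%:R by rewrite divr_ge0// ltW.
apply: content_leW (@content_le_shear_strips _ k x y w _ n w0 hn0) => //.
have -> : n.+1%:R * ((w + `|k| * (h / n.+1%:R)) * (h / n.+1%:R)) =
    w * (n.+1%:R * (h / n.+1%:R)) + `|k| * h ^+ 2 / n.+1%:R.
  by field; rewrite gt_eqF.
rewrite lerD2l ler_pdivrMr// [e * _]mulrC -ler_pdivrMr// ltW//.
exact: truncnS_gt.
Qed.

Definition linear2 (R : realType) (a b c d : R) (p : R * R) : R * R :=
  (a * p.1 + b * p.2, c * p.1 + d * p.2).

(* For [c != 0] the matrix [[a, b], [c, d]] of determinant 1 is the product of
   the shears [[1, (a - 1) / c], [0, 1]], [[1, 0], [c, 1]] and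
   [[1, (d - 1) / c], [0, 1]]. *)
Lemma contracting_linear2 (R : realType) (a b c d : R) :
  a * d - b * c = 1 -> contracting (linear2 a b c d).
Proof.
pose vshear k := @swap R \o shear k \o @swap R.
have cv k : contracting (vshear k).
  apply: contracting_comp (@contracting_swap R).
  exact: contracting_comp (@contracting_swap R) (contracting_shear k).
have main (a' b' c' d' : R) : c' != 0 -> a' * d' - b' * c' = 1 ->
    contracting (linear2 a' b' c' d').
  move=> c0 det1.
  have -> : linear2 a' b' c' d' =
      shear ((a' - 1) / c') \o vshear c' \o shear ((d' - 1) / c').
    apply/funext => -[x y]; rewrite /linear2 /vshear /shear /swap/=.
    have -> : b' = (a' * d' - 1) / c' by rewrite -det1; field.
    by congr pair; field.
  apply: contracting_comp (contracting_shear _).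
  exact: contracting_comp (contracting_shear _) (cv _).
move=> det1; have [c0|c0] := eqVneq c 0; last exact: main.
have d0 : d != 0.
  by apply: contra_eq_neq det1 => ->; rewrite c0 !mulr0 subr0 eq_sym oner_neq0.
(* A vertical shear turns the entry [c = 0] into [c + d = d], which is nonzero because [a d = 1]. *)
have -> : linear2 a b c d = linear2 (a + b) b (c + d) d \o vshear (- 1).
  apply/funext => -[x y]; rewrite /linear2 /vshear /shear /swap/=.
  by congr pair; ring.
apply: contracting_comp (cv _); apply: main; first by rewrite c0 add0r.
by rewrite -det1; ring.
Qed.

(** * Maps of Jacobian determinant 1 do not increase content *)

Lemma prod_norm_max (R : realType) (p : R * R) :
  `|p| = Num.max `|p.1| `|p.2|.
Proof. by []. Qed.

Lemma differentiable_bound (R : realType) (W : normedModType R)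
    (G : R * R -> W) (p : R * R) (e : R) :
  differentiable G p -> 0 < e ->
  exists2 d : R, 0 < d & forall q, sup_close d p q ->
    `|G q - G p - ((q.1 - p.1) *: 'D_(1, 0) G p
                   + (q.2 - p.2) *: 'D_(0, 1) G p)|
      <= e * Num.max `|q.1 - p.1| `|q.2 - p.2|.
Proof.
move=> dG e_gt0; have [_ /eqaddoP/(_ e e_gt0)] := (diff_locallyP p G).1 dG.
move=> /nbhs_sup_closeP[d d_gt0 dP]; exists d => // q [q1 q2].
have cl : sup_close d 0 (q - p) by split; rewrite /= subr0.
have := dP _ cl.
rewrite !deriveE// -!linearZ -linearD/=.
have -> : (q.1 - p.1) *: (1, 0) + (q.2 - p.2) *: (0, 1) = q - p :> R * R.
  case: p q {dG q1 q2 cl dP} => p1 p2 [q1 q2] /=; congr pair => /=.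
    by rewrite /GRing.scale/= mulr1 mulr0 addr0.
  by rewrite /GRing.scale/= mulr1 mulr0 add0r.
have -> // : (G \o shift p - (cst (G p) + 'd G p)) (q - p) =
    G q - G p - 'd G p (q - p).
by rewrite -[LHS]/(G (q - p + p) - (G p + 'd G p (q - p))) subrK opprD addrA.
Qed.

Lemma content_le_four (R : realType) (G : R * R -> R * R) (x y w h c : R) :
  content_le (G @` rect x y w h) c ->
  content_le (G @` rect (x + w) y w h) c ->
  content_le (G @` rect x (y + h) w h) c ->
  content_le (G @` rect (x + w) (y + h) w h) c ->
  content_le (G @` rect x y (w + w) (h + h)) (c * 4).
Proof.
move=> c1 c2 c3 c4.
apply: content_leW (content_leU (content_leU c1 c2) (content_leU c3 c4)).
  move=> _ [p /andP[px py] <-].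
  have [p1|p1] := leP p.1 (x + w); have [p2|p2] := leP p.2 (y + h).
  - by left; left; exists p => //; apply/andP; split; lra.
  - by right; left; exists p => //; apply/andP; split; lra.
  - by left; right; exists p => //; apply/andP; split; lra.
  - by right; right; exists p => //; apply/andP; split; lra.
by rewrite -[4%:R]/(2 + 2)%:R natrD; lra.
Qed.

Lemma rect_enlarge (R : realType) (w h e : R) :
  0 <= w -> 0 <= h -> 0 < e ->
  exists2 k : R, 0 < k & (w + 2 * k) * (h + 2 * k) <= w * h + e.
Proof.
(* For [k <= 1] the excess [2 k (w + h) + 4 k ^ 2] is at most [k D]. *)
move=> w0 h0 e_gt0; pose D := 2 * (w + h) + 4.
have D_gt0 : 0 < D by rewrite /D; lra.
pose k := Num.min 1 (e / D).
have k_gt0 : 0 < k by rewrite lt_min ltr01 divr_gt0.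
have k1 : k <= 1 by rewrite ge_min lexx.
have kD : k * D <= e by rewrite -ler_pdivlMr// ge_min lexx orbT.
exists k => //.
have -> : (w + 2 * k) * (h + 2 * k) = w * h + (2 * k * (w + h) + 4 * (k * k)).
  by ring.
have : k * k <= k by rewrite ler_piMl// ltW.
by rewrite /D in kD; lra.
Qed.

(** On a small rectangle [G] is an affine map [L] of determinant 1 up to an error. Pulled back
    through the inverse matrix, the error becomes a small displacement of the argument, so the image
    lies in the [L]-image of a rectangle enlarged by [t k] on each side. *)
Lemma contracting_differentiable (R : realType) (G : R * R -> R * R) :
  (forall p, differentiable G p) ->
  (forall p, area_form ('D_(1, 0) G p) ('D_(0, 1) G p) = 1) ->
  contracting G.
Proof.
have enlarged (a l u v g k : R) : a <= v <= a + l -> `|g| <= k ->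
    a - u - k <= v - u + g <= a - u - k + (l + 2 * k).
  by rewrite ler_norml => *; apply/andP; split; lra.
move=> dG detG x y w h w0 h0; apply: content_le_lim => e e_gt0.
(* The bound scales like [t ^ 2], so the bounds of the four quarters add up exactly to that of the
   whole. *)
suff H : forall x y t, 0 < t ->
    content_le (G @` rect x y (t * w) (t * h)) (t ^+ 2 * (w * h + e)).
  by have := H x y 1 ltr01; rewrite !mul1r expr1n mul1r.
move=> {x y}; apply: (@rect_bisection R w h (fun x y t =>
    content_le (G @` rect x y (t * w) (t * h)) (t ^+ 2 * (w * h + e)))) => //.
  move=> x y t t_gt0 c1 c2 c3 c4.
  have := content_le_four c1 c2 c3 c4.
  have half z : t / 2 * z + t / 2 * z = t * z by field.
  rewrite !half; apply: content_leW => //.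
  by rewrite le_eqVlt; apply/orP; left; apply/eqP; field.
move=> p; have := detG p.
have := differentiable_bound (dG p).
case: ('D_(1, 0) G p) ('D_(0, 1) G p) => a c [b d] dGp.
rewrite /area_form/= => det1.
(* [t M] bounds both sides, and its summand 1 keeps it positive for degenerate rectangles. The
   factor 2 in [C] shares the margin [t k] between the two terms in each coordinate of the
   displacement. *)
pose M := w + h + 1; pose C := (`|a| + `|b| + `|c| + `|d|) * 2 + 1.
have M_gt0 : 0 < M by rewrite /M; lra.
have := normr_ge0 a; have := normr_ge0 b.
have := normr_ge0 c; have := normr_ge0 d => nd nc nb na.
have C_gt0 : 0 < C by rewrite /C; lra.
have [k k_gt0 ke] := rect_enlarge w0 h0 e_gt0.
have eps_gt0 : 0 < k / (C * M) by rewrite divr_gt0// mulr_gt0.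
have [r r_gt0 rP] := dGp _ eps_gt0.
exists (r / M); first by rewrite divr_gt0.
move=> x y t /andP[t_gt0]; rewrite ltr_pdivlMr// => tMr /andP[px py].
have tk0 : 0 < t * k by rewrite mulr_gt0.
have tw0 : 0 <= t * w by rewrite mulr_ge0// ltW.
have th0 : 0 <= t * h by rewrite mulr_ge0// ltW.
have tM : t * M = t * w + t * h + t by rewrite /M; ring.
pose L := (fun q => q + G p) \o linear2 a b c d.
have cL : contracting L.
  apply: contracting_comp; first exact: contracting_translation.
  by apply: contracting_linear2; rewrite -det1; ring.
have W0 : 0 <= t * w + 2 * (t * k) by lra.
have H0 : 0 <= t * h + 2 * (t * k) by lra.
apply: content_leW
  (cL (x - p.1 - t * k) (y - p.2 - t * k) _ _ W0 H0); last first.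
  have -> : (t * w + 2 * (t * k)) * (t * h + 2 * (t * k)) =
    t ^+ 2 * ((w + 2 * k) * (h + 2 * k)) by ring.
  by rewrite ler_wpM2l// exprn_ge0// ltW.
move=> _ [q /andP[qx qy] <-].
have d1 : `|q.1 - p.1| <= t * w by rewrite ler_norml; apply/andP; split; lra.
have d2 : `|q.2 - p.2| <= t * h by rewrite ler_norml; apply/andP; split; lra.
have qp : sup_close r p q by split; lra.
have := rP q qp.
rewrite prod_norm_max ge_max => /andP[f1m0 f2m0].
pose m : R := Num.max `|q.1 - p.1| `|q.2 - p.2|.
have mtM : m <= t * M by rewrite ge_max; apply/andP; split; lra.
set f1 : R := (G q).1 - (G p).1 - ((q.1 - p.1) * a + (q.2 - p.2) * b).
set f2 : R := (G q).2 - (G p).2 - ((q.1 - p.1) * c + (q.2 - p.2) * d).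
have f1m : `|f1| <= k / (C * M) * m := f1m0.
have f2m : `|f2| <= k / (C * M) * m := f2m0.
have bound (f : R) : `|f| <= k / (C * M) * m -> C * `|f| <= t * k.
  move=> fm; have -> : t * k = C * (k / (C * M) * (t * M)).
    by field; rewrite !gt_eqF.
  apply: ler_wpM2l; first exact: ltW.
  apply: le_trans fm _; apply: ler_wpM2l => //.
  by rewrite divr_ge0// ltW// mulr_gt0.
have {}f1m := bound _ f1m; have {}f2m := bound _ f2m.
have expandC (f : R) : C * `|f| = (`|a| * `|f| + `|b| * `|f| + `|c| * `|f|
   + `|d| * `|f|) * 2 + `|f| by rewrite /C; ring.
rewrite !expandC -!normrM in f1m f2m.
(* The vector [q - p] displaced by the inverse matrix applied to the error [(f1, f2)]: [L] sends it
   exactly to [G q]. *)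
exists (q.1 - p.1 + (d * f1 - b * f2), q.2 - p.2 + (a * f2 - c * f1)).
  have := normr_ge0 f1; have := normr_ge0 f2.
  have := normr_ge0 (c * f1); have := normr_ge0 (a * f2).
  have := normr_ge0 (d * f1); have := normr_ge0 (b * f2).
  have := normr_ge0 (a * f1); have := normr_ge0 (b * f1).
  have := normr_ge0 (c * f2); have := normr_ge0 (d * f2) => *.
  have : `|d * f1 - b * f2| <= t * k.
    by apply: le_trans (ler_normB _ _) _; lra.
  have : `|a * f2 - c * f1| <= t * k.
    by apply: le_trans (ler_normB _ _) _; lra.
  by move=> g2 g1; apply/andP; split; exact: enlarged.
rewrite [RHS]surjective_pairing /L /linear2 /=; congr pair => /=.
  transitivity (a * (q.1 - p.1) + b * (q.2 - p.2) + (a * d - c * b) * f1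
                + (G p).1); first by ring.
  by rewrite det1 /f1; ring.
transitivity (c * (q.1 - p.1) + d * (q.2 - p.2) + (a * d - c * b) * f2
              + (G p).2); first by ring.
by rewrite det1 /f2; ring.
Qed.

(** * Exact maps have Jacobian determinant 1 *)

Lemma cvg_is_derive (R : realType) (f : R -> R) (x d : R) :
  h^-1 *: (f (h *: 1 + x) - f x) @[h --> 0^'] --> d -> is_derive x 1 f d.
Proof.
move=> fd; apply: DeriveDef; first by apply/cvg_ex; exists d.
exact/cvg_lim.
Qed.

Lemma cvg_derive_line (R : realType) (W : normedModType R) (F : R * R -> W)
    (v : R * R) (c : R -> R * R) (s : R) :
  (forall h : R, h *: v + c s = c (h *: 1 + s)) -> differentiable F (c s) ->
  h^-1 *: (F (c (h *: 1 + s)) - F (c s)) @[h --> 0^'] --> 'D_v F (c s).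
Proof.
move=> cv dF; have /cvg_ex[l Fl] : derivable F (c s) v by exact: diff_derivable.
have -> : 'D_v F (c s) = l by exact/cvg_lim.
apply: cvg_trans Fl; apply: near_eq_cvg; apply: nearW => h.
by rewrite /= cv.
Qed.

Lemma is_derive_line (R : realType) (F : R * R -> R)
    (v : R * R) (c : R -> R * R) (s : R) :
  (forall h : R, h *: v + c s = c (h *: 1 + s)) -> differentiable F (c s) ->
  is_derive s 1 (F \o c) ('D_v F (c s)).
Proof. by move=> cv dF; apply: cvg_is_derive; exact: cvg_derive_line. Qed.

Lemma is_derive_line1 (R : realType) (F : R * R -> R * R)
    (v : R * R) (c : R -> R * R) (s : R) :
  (forall h : R, h *: v + c s = c (h *: 1 + s)) -> differentiable F (c s) ->
  is_derive s 1 (fun s => (F (c s)).1) ('D_v F (c s)).1.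
Proof.
move=> cv dF; apply: cvg_is_derive.
have FD := cvg_derive_line cv dF.
have H := cvg_comp _ _ FD (@continuous_fst R R ('D_v F (c s))).
exact: H.
Qed.

(** Differentiability of [A] at the single point [p], with partial derivatives [a1] and [a2]. *)
Definition linear_part (R : realType) (A : R * R -> R) (p : R * R) (a1 a2 : R) :
    Prop :=
  forall e : R, 0 < e -> exists2 d : R, 0 < d & forall q, sup_close d p q ->
    `|A q - A p - ((q.1 - p.1) * a1 + (q.2 - p.2) * a2)|
      <= e * Num.max `|q.1 - p.1| `|q.2 - p.2|.

(** The mean value theorem for the vertical increment of [S] as a function of the abscissa. *)
Lemma mixed_difference (R : realType) (S A : R -> R -> R) (x y t : R) :
  (forall x y : R, is_derive x 1 (S ^~ y : R -> R) (A x y)) -> 0 < t ->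
  exists2 z, x < z < x + t &
    S (x + t) (y + t) - S (x + t) y - (S x (y + t) - S x y) =
    t * (A z (y + t) - A z y).
Proof.
move=> SA t_gt0.
have dphi (z : R) : is_derive z 1 (fun s : R => S s (y + t) - S s y)
    (A z (y + t) - A z y).
  by apply: is_deriveB.
have cphi : {within `[x, x + t], continuous (fun s => S s (y + t) - S s y)}.
  by apply: derivable_within_continuous => z _; exact: ex_derive.
have xt : x < x + t by rewrite ltrDl.
have [z zx ->] := MVT xt (fun z _ => dphi z) cphi.
by exists z; [rewrite in_itv in zx|rewrite [x + t]addrC addrK mulrC].
Qed.

(** The expansion of [A] at [(x, y)] is used at two points of the same abscissa, so the [a1] terms
    cancel and the mixed difference is [t ^ 2 * a2] up to a small multiple of [t ^ 2]. *)
Lemma young_half (R : realType) (S A : R -> R -> R) (x y a1 a2 e : R) :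
  (forall x y : R, is_derive x 1 (S ^~ y : R -> R) (A x y)) ->
  linear_part (fun q => A q.1 q.2) (x, y) a1 a2 -> 0 < e ->
  exists2 d : R, 0 < d & forall t, 0 < t < d ->
    `|S (x + t) (y + t) - S (x + t) y - (S x (y + t) - S x y) - t ^+ 2 * a2|
      <= t ^+ 2 * e.
Proof.
move=> SA lA e_gt0; have e2 : 0 < e / 2 by rewrite divr_gt0.
have [d d_gt0 dP] := lA _ e2; exists d => // t /andP[t_gt0 td].
have [z /andP[xz zt] ->] := mixed_difference x y SA t_gt0.
have zx : `|z - x| < t by rewrite ltr_norml; apply/andP; split; lra.
have m0 : Num.max `|z - x| `|y - y| <= t.
  by rewrite ge_max subrr normr0 !ltW.
have mt : Num.max `|z - x| `|y + t - y| <= t.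
  by rewrite ge_max (ltW zx) [y + t]addrC addrK (gtr0_norm t_gt0) lexx.
have c0 : sup_close d (x, y) (z, y).
  by split => /=; [exact: lt_trans td|rewrite subrr normr0].
have ct : sup_close d (x, y) (z, y + t).
  by split => /=; [exact: lt_trans td|rewrite [y + t]addrC addrK gtr0_norm].
have := dP _ c0; have := dP _ ct => /=.
move=> /le_trans/(_ (ler_wpM2l (ltW e2) mt)) Ht.
move=> /le_trans/(_ (ler_wpM2l (ltW e2) m0)) H0.
have -> : t * (A z (y + t) - A z y) - t ^+ 2 * a2 =
    t * ((A z (y + t) - A x y - ((z - x) * a1 + (y + t - y) * a2))
       - (A z y - A x y - ((z - x) * a1 + (y - y) * a2))) by ring.
rewrite normrM gtr0_norm// expr2 -mulrA ler_pM2l//.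
apply: le_trans (ler_normB _ _) _; lra.
Qed.

(* Young's form of the symmetry of second derivatives: the first partial
   derivatives are only differentiable at the point itself. *)
Lemma young (R : realType) (S A B : R * R -> R) (x y a1 a2 b1 b2 : R) :
  (forall x y : R, is_derive x 1 (fun s : R => S (s, y)) (A (x, y))) ->
  (forall x y : R, is_derive y 1 (fun s : R => S (x, s)) (B (x, y))) ->
  linear_part A (x, y) a1 a2 -> linear_part B (x, y) b1 b2 -> a2 = b1.
Proof.
move=> SA SB lA lB.
have lA' : linear_part (fun q => A (q.1, q.2)) (x, y) a1 a2.
  by move=> e /lA[d d_gt0 dP]; exists d => // -[q1 q2]; exact: dP.
(* [young_half] is used a second time with the coordinates exchanged, which leaves the mixed
   difference of [S] unchanged. *)
have lB' : linear_part (fun q => B (q.2, q.1)) (y, x) b2 b1.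
  move=> e /lB[d d_gt0 dP]; exists d => // q [q1 q2].
  by rewrite maxC [X in _ - X]addrC; exact: (dP (q.2, q.1)).
apply/eqP; rewrite -subr_eq0 -normr_eq0; apply: contraT => n0.
(* Two errors of a quarter of the gap cannot make up the whole gap. *)
have e_gt0 : 0 < `|a2 - b1| / 4 by rewrite divr_gt0// lt_def n0 normr_ge0.
have [d1 d1_gt0 d1P] := @young_half _ (fun x y => S (x, y))
  (fun x y => A (x, y)) x y a1 a2 _ SA lA' e_gt0.
have [d2 d2_gt0 d2P] := @young_half _ (fun y x => S (x, y))
  (fun y x => B (x, y))
  y x b2 b1 _ (fun y x => SB x y) lB' e_gt0.
pose t := Num.min d1 d2 / 2.
have m_gt0 : 0 < Num.min d1 d2 by rewrite lt_min d1_gt0.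
have t_gt0 : 0 < t by rewrite divr_gt0.
have tm : t < Num.min d1 d2 by rewrite /t; lra.
have [t1 t2] : 0 < t < d1 /\ 0 < t < d2.
  by move: tm; rewrite t_gt0 lt_min => /andP.
have {}d1P := d1P t t1; have {}d2P := d2P t t2.
have : t ^+ 2 * `|a2 - b1| <=
    t ^+ 2 * (`|a2 - b1| / 4) + t ^+ 2 * (`|a2 - b1| / 4).
  have {1}-> : t ^+ 2 = `|t ^+ 2| by rewrite ger0_norm// exprn_ge0// ltW.
  rewrite -normrM; apply: (le_trans _ (lerD d2P d1P)).
  apply: (le_trans _ (ler_normB _ _)).
  by rewrite le_eqVlt; apply/orP; left; apply/eqP; congr Num.norm; ring.
rewrite -mulrDr ler_pM2l ?exprn_gt0// => H; exfalso; lra.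
Qed.

(** Since [Y q] is of the order of the distance from [q] to [p], replacing [psi q] by [psi p] costs
    only a smaller order, although [psi] is merely continuous. *)
Lemma linear_part_mul (R : realType) (Y psi : R * R -> R) (p : R * R)
    (y1 y2 : R) :
  Y p = 0 -> {for p, continuous psi} -> linear_part Y p y1 y2 ->
  linear_part (fun q => Y q * psi q) p (y1 * psi p) (y2 * psi p).
Proof.
move=> Yp cpsi lY e e_gt0.
(* The error of [Y] contributes [k (|psi p| + 1)] and the variation of [psi] contributes
   [k (|y1| + |y2|)]. *)
pose C := `|psi p| + 1 + `|y1| + `|y2|.
have := normr_ge0 (psi p); have := normr_ge0 y1; have := normr_ge0 y2.
move=> ny2 ny1 npsi.
have C_gt0 : 0 < C by rewrite /C; lra.
pose k := Num.min 1 (e / C).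
have k_gt0 : 0 < k by rewrite lt_min ltr01 divr_gt0.
have kC : k * C <= e by rewrite -ler_pdivlMr// ge_min lexx orbT.
have [d1 d1_gt0 d1P] := lY _ k_gt0.
have /nbhs_sup_closeP[d2 d2_gt0 d2P] : \forall q \near p, `|psi p - psi q| < k.
  by move/cvgrPdist_lt : cpsi; exact.
exists (Num.min d1 d2); first by rewrite lt_min d1_gt0.
move=> q [q1 q2]; move: q1 q2; rewrite !lt_min => /andP[q11 q12] /andP[q21 q22].
have := d1P q (conj q11 q21); have /= := d2P q (conj q12 q22).
rewrite Yp mul0r !subr0.
set m := Num.max _ _; set f := Y q - _ => psi_k fm.
have m1 : `|q.1 - p.1| <= m by rewrite le_max lexx.
have m2 : `|q.2 - p.2| <= m by rewrite le_max lexx orbT.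
have m_ge0 : 0 <= m by exact: le_trans m1.
have -> : Y q * psi q
      - ((q.1 - p.1) * (y1 * psi p) + (q.2 - p.2) * (y2 * psi p)) =
    f * psi q - ((q.1 - p.1) * y1 + (q.2 - p.2) * y2) * (psi p - psi q).
  by rewrite /f; ring.
have psi_q : `|psi q| <= `|psi p| + 1.
  have k1 : k <= 1 by rewrite ge_min lexx.
  have := ler_normB (psi p) (psi p - psi q); rewrite opprB addrC subrK; lra.
apply: le_trans (ler_normB _ _) _; rewrite !normrM.
have b1 : `|f| * `|psi q| <= (k * m) * (`|psi p| + 1) by apply: ler_pM.
have b2 : `|(q.1 - p.1) * y1 + (q.2 - p.2) * y2| * `|psi p - psi q| <=
    (m * `|y1| + m * `|y2|) * k.
  apply: ler_pM => //; last exact: ltW.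
  apply: le_trans (ler_normD _ _) _; rewrite !normrM.
  by apply: lerD; apply: ler_wpM2r.
apply: le_trans (lerD b1 b2) _.
have -> : k * m * (`|psi p| + 1) + (m * `|y1| + m * `|y2|) * k = k * C * m.
  by rewrite /C; ring.
exact: ler_wpM2r.
Qed.

Lemma linear_part_sub_snd (R : realType) (A : R * R -> R) (p : R * R)
    (a1 a2 c : R) :
  linear_part A p a1 a2 ->
  linear_part (fun q => A q - (q.2 - c)) p a1 (a2 - 1).
Proof.
move=> lA e /lA[d d_gt0 dP]; exists d => // q /dP; apply: le_trans.
by rewrite le_eqVlt; apply/orP; left; apply/eqP; congr Num.norm; ring.
Qed.

(* [G = (X, Y)] is only C1, so the exterior derivative of the pulled back form is
   not available. But the partial derivatives of [S - Y(p) X + p.2 x], namely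
   [(Y - Y(p)) X_x - (y - p.2)] and [(Y - Y(p)) X_y], are differentiable at [p]
   because [Y - Y(p)] vanishes there, so [young] applies. *)
Lemma exact_det1 (R : realType) (G : R * R -> R * R) (S : R * R -> R) :
  C1 G -> C1 S ->
  (forall p v : R * R, 'D_v S p = liouville (G p) ('D_v G p) - liouville p v) ->
  forall p : R * R, area_form ('D_(1, 0) G p) ('D_(0, 1) G p) = 1.
Proof.
move=> [dG cG] [dS _] SG [x0 y0]; pose p : R * R := (x0, y0).
pose DG1 q : R := ('D_(1, 0) G q).1; pose DG2 q : R := ('D_(0, 1) G q).1.
pose Y (q : R * R) : R := (G q).2 - (G p).2.
pose T (q : R * R) : R := S q - (G p).2 * (G q).1 + y0 * q.1.
have line1 (x y h : R) :
    h *: (1, 0) + (x, y) = (h *: (1 : R) + x, y) :> R * R.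
  by congr pair; rewrite /= ?scaler0 ?add0r.
have line2 (x y h : R) :
    h *: (0, 1) + (x, y) = (x, h *: (1 : R) + y) :> R * R.
  by congr pair; rewrite /= ?scaler0 ?add0r.
have TA (x y : R) : is_derive x 1 (fun s : R => T (s, y))
    (Y (x, y) * DG1 (x, y) - (y - y0)).
  have dS1 :=
    @is_derive_line R S (1, 0) (fun s => (s, y)) x (line1 x y) (dS (x, y)).
  have dG1 :=
    @is_derive_line1 R G (1, 0) (fun s => (s, y)) x (line1 x y) (dG (x, y)).
  rewrite /T/=; apply: is_derive_eq.
  by rewrite SG /liouville /Y /DG1 /GRing.scale/=; ring.
have TB (x y : R) :
    is_derive y 1 (fun s : R => T (x, s)) (Y (x, y) * DG2 (x, y)).
  have dS2 :=
    @is_derive_line R S (0, 1) (fun s => (x, s)) y (line2 x y) (dS (x, y)).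
  have dG2 :=
    @is_derive_line1 R G (0, 1) (fun s => (x, s)) y (line2 x y) (dG (x, y)).
  rewrite /T/=; apply: is_derive_eq.
  by rewrite SG /liouville /Y /DG2 /GRing.scale/=; ring.
have Yp : Y p = 0 by rewrite /Y subrr.
have cDG v : {for p, continuous (fun q => ('D_v G q).1)}.
  exact: (cvg_comp _ _ (cG v p) (@continuous_fst R R ('D_v G p))).
have lY : linear_part Y p ('D_(1, 0) G p).2 ('D_(0, 1) G p).2.
  move=> e /(differentiable_bound (dG p))[d d_gt0 dP].
  exists d => // q /dP; rewrite prod_norm_max ge_max => /andP[_ GY].
  by rewrite Yp subr0; exact: GY.
have lA := linear_part_mul Yp (cDG (1, 0)) lY.
have lB := linear_part_mul Yp (cDG (0, 1)) lY.
have lA' := linear_part_sub_snd y0 lA.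
(* With [G = (X, Y)], the symmetry reads [X_x Y_y - 1 = Y_x X_y] at [p]. *)
have /eqP := young TA TB lA' lB; rewrite -/p /area_form subr_eq => /eqP H.
by apply/eqP; rewrite subr_eq addrC mulrC -H mulrC.
Qed.

(** * Lifts of maps of the annulus *)

Lemma annulus_piB (R : realType) (p q : R * R) :
  annulus_pi (p - q) = annulus_pi p - annulus_pi q.
Proof. by congr pair; rewrite /= angleD angleN. Qed.

Lemma annulus_pi_int (R : realType) (p : R * R) (k : R) :
  k \is a Num.int -> annulus_pi (p + (k, 0)) = annulus_pi p.
Proof. by move=> kZ; apply/annulus_pi_eq; rewrite /= addr0 addrC addKr. Qed.

Lemma lift_map (R : realType) (g : annulus R -> annulus R) :
  continuous g -> exists G, continuous G /\ lifts G g.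
Proof.
move=> cg; have cgpi := continuous_after (@annulus_pi_continuous R) cg.
have [U [cU Ug]] := lift_exists (continuous_after cgpi (@continuous_fst _ _)).
exists (fun p => (U p, (g (annulus_pi p)).2)); split.
  apply: continuous_pair => //.
  exact: continuous_after cgpi (@continuous_snd _ _).
by move=> p; rewrite /annulus_pi/= Ug /= -surjective_pairing.
Qed.

(** The difference of the first coordinates is continuous and integer valued, hence constant. *)
Lemma lifts_unique (R : realType) (G G' : R * R -> R * R)
    (g : annulus R -> annulus R) :
  continuous G -> continuous G' -> lifts G g -> lifts G' g ->
  exists2 k : R, k \is a Num.int & forall p, G p = G' p + (k, 0).
Proof.
move=> cG cG' Gg G'g; pose u p := (G p).1 - (G' p).1.
have GG' p : u p \is a Num.int /\ (G p).2 = (G' p).2.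
  by apply/annulus_pi_eq; rewrite Gg G'g.
have cu : continuous u.
  move=> p; apply: cvgB.
    exact: (continuous_after cG (@continuous_fst _ _)).
  exact: (continuous_after cG' (@continuous_fst _ _)).
have uc := int_valued_constant cu (fun p => (GG' p).1).
exists (u 0); first exact: (GG' 0).1.
move=> p; rewrite -(uc p) [LHS]surjective_pairing (GG' p).2.
rewrite [in RHS](surjective_pairing (G' p)).
by congr pair; rewrite /= ?addr0// /u addrC subrK.
Qed.

Lemma translation_continuous (R : realType) (v : R * R) :
  continuous (fun p : R * R => p + v).
Proof. by move=> p; apply: cvgD; [exact: cvg_id|exact: cvg_cst]. Qed.

(** Translating the argument by a period gives another lift; [k] is the degree of [g] along the
    circle. *)
Lemma lifts_period (R : realType) (G : R * R -> R * R)
    (g : annulus R -> annulus R) :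
  continuous G -> lifts G g ->
  exists2 k : R, k \is a Num.int & forall p, G (p + (1, 0)) = G p + (k, 0).
Proof.
move=> cG Gg; apply: (@lifts_unique R (fun p => G (p + (1, 0))) G g) => //.
  exact: continuous_after (@translation_continuous R (1, 0)) cG.
by move=> p; rewrite Gg annulus_pi_int// rpred1.
Qed.

(** Both composites of [F] and [F'] lift the identity, so they are integer translations, and one of
    these is absorbed into [F']. *)
Lemma lifts_inverse (R : realType) (f f' : annulus R -> annulus R)
    (F F' : R * R -> R * R) :
  cancel f f' -> cancel f' f -> continuous F -> continuous F' ->
  lifts F f -> lifts F' f' ->
  exists k : R, [/\ k \is a Num.int,
    cancel F (fun p => F' (p + (k, 0))) & cancel (fun p => F' (p + (k, 0))) F].
Proof.
move=> fK f'K cF cF' Ff F'f'.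
have [k kZ FF'] : exists2 k : R, k \is a Num.int &
    forall p, F (F' p) = p + (k, 0).
  apply: (@lifts_unique R (F \o F') id id) => //.
  - exact: continuous_after cF' cF.
  - by move=> p; exact: cvg_id.
  - by move=> p; rewrite /= Ff F'f' f'K.
have [k' k'Z F'F] : exists2 k : R, k \is a Num.int &
    forall p, F' (F p) = p + (k, 0).
  apply: (@lifts_unique R (F' \o F) id id) => //.
  - exact: continuous_after cF cF'.
  - by move=> p; exact: cvg_id.
  - by move=> p; rewrite /= F'f' Ff fK.
have F'K : cancel (fun p => F' (p + (- k, 0))) F.
  by move=> p; rewrite FF' -addrA -[X in _ + X]/(- k + k, 0 + 0) addNr !addr0.
exists (- k); split=> //; first by rewrite rpredN.
move=> p; apply: (addIr (k', 0)); rewrite -!F'F; congr F'; exact: F'K.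
Qed.

Lemma derive_comp (K : numFieldType) (U V W : normedModType K) (f : U -> V)
    (g : V -> W) (a v : U) :
  differentiable f a -> differentiable g (f a) ->
  'D_v (fun x => g (f x)) a = 'D_('D_v f a) g (f a).
Proof.
move=> df dg; rewrite (deriveE _ df) (deriveE _ dg).
by rewrite (deriveE _ (differentiable_comp df dg)) (diff_comp df dg).
Qed.

Lemma area_form_derive (R : realType) (G : R * R -> R * R) (p u v : R * R) :
  differentiable G p ->
  area_form ('D_u G p) ('D_v G p) =
  area_form u v * area_form ('D_(1, 0) G p) ('D_(0, 1) G p).
Proof.
move=> dG; have DG (w : R * R) :
    'D_w G p = w.1 *: 'D_(1, 0) G p + w.2 *: 'D_(0, 1) G p.
  rewrite !deriveE// -!linearZ -linearD; congr ('d G p _).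
  case: w => a b; congr pair;
  by rewrite /= /GRing.scale/= ?mulr0 ?mulr1 ?addr0 ?add0r.
rewrite (DG u) (DG v); case: ('D_(1, 0) G p) ('D_(0, 1) G p) => a b [c d].
by rewrite /area_form/= /GRing.scale/=; ring.
Qed.

(** The inverse is part of the data: an upper bound on the content of images says nothing about
    preimages, and the limit argument pulls segments back by [G]. *)
Definition area_contracting_pair (R : realType) (G G' : R * R -> R * R) :=
  [/\ continuous G /\ continuous G', cancel G G', cancel G' G,
      contracting G & contracting G'].

Lemma C1_continuous (R : realType) (G : R * R -> R * R) : C1 G -> continuous G.
Proof. by move=> [dG _] p; exact: differentiable_continuous. Qed.

Lemma diffeomorphism_contracting (R : realType) (g : annulus R -> annulus R) :
  diffeomorphism g ->
  (forall G, lifts G g -> C1 G ->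
    forall p, area_form ('D_(1, 0) G p) ('D_(0, 1) G p) = 1) ->
  exists G G', lifts G g /\ area_contracting_pair G G'.
Proof.
move=> [[G [Gg C1G]] [h [gK hK [H [Hh C1H]]]]] det1.
have cG := C1_continuous C1G; have cH := C1_continuous C1H.
have [k [kZ GK HK]] := lifts_inverse gK hK cG cH Gg Hh.
have detG := det1 G Gg C1G.
have [dG _] := C1G; have [dH _] := C1H.
(* [G \o H] is a translation, so by the chain rule the determinants of [G] and [H] multiply to 1. *)
have detH p : area_form ('D_(1, 0) H p) ('D_(0, 1) H p) = 1.
  have D (v : R * R) : 'D_('D_v H p) G (H p) = v.
    have GH : (fun q => G (H q)) = (fun q => q - (k, 0)).
      apply/funext => q; rewrite -[in LHS](subrK (k, 0) q).
      exact: (HK (q - (k, 0))).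
    have DGH : 'D_v (fun q => G (H q)) p = v.
      rewrite GH; have : is_derive p v (fun q : R * R => q - (k, 0)) (v - 0).
        by apply: is_deriveB.
      by move=> /@derive_val ->; rewrite subr0.
    exact: etrans (esym (derive_comp v (dH p) (dG (H p)))) DGH.
  pose u := 'D_(1, 0) H p; pose v := 'D_(0, 1) H p.
  transitivity (area_form u v * 1); first by rewrite mulr1.
  apply: (etrans (esym (congr1 ( *%R (area_form u v)) (detG (H p))))).
  apply: (etrans (esym (area_form_derive u v (dG (H p))))).
  apply: (etrans (congr2 (@area_form R) (D (1, 0)) (D (0, 1)))).
  by rewrite /area_form/= mulr1 mulr0 subr0.
exists G, (fun p => H (p + (k, 0))); split => //; split => //.
- split => //; exact: continuous_after (@translation_continuous R (k, 0)) cH.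
- exact: contracting_differentiable.
- apply: contracting_comp (contracting_translation (k, 0)).
  exact: contracting_differentiable.
Qed.

(** * Content is not increased in the limit *)

Lemma area_contracting_pair_translate (R : realType) (G G' : R * R -> R * R)
    (v : R * R) :
  area_contracting_pair G G' ->
  area_contracting_pair (fun p => G p + v) (fun p => G' (p - v)).
Proof.
move=> [[cG cG'] GK G'K kG kG']; split.
- split; first exact: continuous_after cG (@translation_continuous R v).
  exact: continuous_after (@translation_continuous R (- v)) cG'.
- by move=> p; rewrite addrK GK.
- by move=> p; rewrite G'K subrK.
- exact: contracting_comp (contracting_translation v) kG.
- exact: contracting_comp kG' (contracting_translation (- v)).
Qed.

(** A lift of [g n] is close to [F] only up to an integer that could depend on the point. The bound
    [e' <= 1 / 2] makes this integer constant along segments, hence on the square, and translating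
    the lift removes it. *)
Lemma approx_lift (R : realType) (P : (annulus R -> annulus R) -> Prop)
    (f : annulus R -> annulus R) (F : R * R -> R * R) (x y t e : R) :
  (forall g, P g -> exists G G', lifts G g /\ area_contracting_pair G G') ->
  locally_uniform_limit P f -> continuous F -> lifts F f ->
  0 < t -> 0 < e ->
  exists g G G', [/\ P g, lifts G g, area_contracting_pair G G' &
    forall q, rect x y t t q -> sup_close e (F q) (G q)].
Proof.
move=> P_lift [g [gP gf]] cF Ff t_gt0 e_gt0.
pose e' := Num.min e (1 / 2).
have e'_gt0 : 0 < e' by rewrite lt_min e_gt0; lra.
have e'e : e' <= e by rewrite ge_min lexx.
have e'2 : e' <= 1 / 2 by rewrite ge_min lexx orbT.
pose W := @annulus_pi R @` [set v | sup_close e' 0 v].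
have nW : nbhs (0 : annulus R) W.
  have <- : annulus_pi (0 : R * R) = 0.
    by rewrite -[X in annulus_pi X](subrr 0) annulus_piB subrr.
  by apply: nbhs_annulus_pi; apply/nbhs_sup_closeP; exists e'.
(* Local uniform convergence becomes uniform on squares by bisection. *)
have gW : forall x y t, 0 < t -> \forall n \near \oo,
    forall q, rect x y (t * 1) (t * 1) q ->
    W (g n (annulus_pi q) - f (annulus_pi q)).
  apply: (@rect_bisection R 1 1 (fun x y t => \forall n \near \oo,
    forall q, rect x y (t * 1) (t * 1) q ->
    W (g n (annulus_pi q) - f (annulus_pi q)))) => //.
    move=> {t_gt0} {}x {}y {}t t_gt0; rewrite !mulr1 => n1 n2 n3 n4.
    apply: filterS (filterI (filterI n1 n2) (filterI n3 n4)).
    move=> n [[h1 h2] [h3 h4]] q /andP[qx qy].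
    have [q1|q1] := leP q.1 (x + t / 2); have [q2|q2] := leP q.2 (y + t / 2).
    - by apply: h1; apply/andP; split; lra.
    - by apply: h3; apply/andP; split; lra.
    - by apply: h2; apply/andP; split; lra.
    - by apply: h4; apply/andP; split; lra.
  move=> p; have [U [/annulus_pi_continuous/nbhs_sup_closeP[d d_gt0 dU] gfU]] :=
    gf (annulus_pi p).
  exists d => // {}x {}y s /andP[s_gt0 sd] /andP[px py].
  apply: filterS (gfU W nW) => n Wn q /andP[qx qy]; apply: Wn; apply: dU.
  by split; rewrite ltr_norml; apply/andP; split; lra.
have [n] := filter_ex (gW x y t t_gt0); rewrite mulr1 => {gW} Wn.
have [G [G' [Gg GG']]] := P_lift (g n) (gP n).
have GF q : rect x y t t q -> exists2 k : R, k \is a Num.int &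
    sup_close e' (F q + (k, 0)) (G q).
  move=> /Wn[v [v1 v2]].
  rewrite -Gg -Ff -annulus_piB => /annulus_pi_eq[v1Z v2E].
  exists ((G q).1 - (F q).1 - v.1).
    by rewrite -opprB rpredN.
  move: v1 v2; rewrite /= !subr0 v2E /= => v1 v2.
  split; rewrite /= ?addr0//.
  by have -> : (G q).1 - ((F q).1 + ((G q).1 - (F q).1 - v.1)) = v.1 by ring.
have p0 : rect x y t t (x, y).
  by apply/andP; split => /=; rewrite lexx lerDl ltW.
have [k kZ kP] := GF _ p0.
exists (g n), (fun p => G p + (- k, 0)), (fun p => G' (p - (- k, 0))).
split => //.
- by move=> p; rewrite annulus_pi_int// rpredN.
- exact: area_contracting_pair_translate.
move=> q qR; have [k' k'Z k'P] := GF _ qR.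
suff kk' : k = k'.
  case: k'P => /=; rewrite -kk' addr0 => Gq1 Gq2; split => /=.
    apply: lt_le_trans e'e.
    by have -> : (G q).1 + - k - (F q).1 = (G q).1 - ((F q).1 + k) by ring.
  by rewrite addr0; exact: lt_le_trans e'e.
have [[cG cG'] _ _ _ _] := GG'.
apply: (@int_near_segment R (fun p => (G p).1 - (F p).1) (x, y) q) => //.
- move=> p; apply: cvgB.
    exact: (continuous_after cG (@continuous_fst _ _)).
  exact: (continuous_after cF (@continuous_fst _ _)).
- move=> s s01.
  have /GF[j jZ [/= j1 _]] : rect x y t t (seg (x, y) q s).
    move: qR => /andP[qx qy]; rewrite /seg/=.
    have sx : 0 <= s * (q.1 - x) by apply: mulr_ge0; lra.
    have sy : 0 <= s * (q.2 - y) by apply: mulr_ge0; lra.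
    have sx' : s * (q.1 - x) <= q.1 - x by apply: ler_piMl; lra.
    have sy' : s * (q.2 - y) <= q.2 - y by apply: ler_piMl; lra.
    by apply/andP; split => /=; lra.
  exists j => //; apply: lt_le_trans e'2; move: j1.
  by rewrite opprD addrA.
- by case: kP => /= + _; rewrite opprD addrA => /lt_le_trans; exact.
- by case: k'P => /= + _; rewrite opprD addrA => /lt_le_trans; exact.
Qed.

Lemma image_bounded (R : realType) (F : R * R -> R * R) (x y w h : R) :
  0 <= w -> 0 <= h -> continuous F ->
  exists2 M : R, 0 < M & forall q, rect x y w h q ->
    rect (- M) (- M) (M + M) (M + M) (F q).
Proof.
move=> w0 h0 cF.
suff H : forall x y t, 0 < t -> exists2 M : R, 0 < M &
    forall q, rect x y (t * w) (t * h) q ->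
    rect (- M) (- M) (M + M) (M + M) (F q).
  by have := H x y 1 ltr01; rewrite !mul1r.
have mono (M N : R) p : M <= N -> rect (- M) (- M) (M + M) (M + M) p ->
    rect (- N) (- N) (N + N) (N + N) p.
  by move=> MN /andP[p1 p2]; apply/andP; split; lra.
move=> {x y}; apply: (@rect_bisection R w h (fun x y t => exists2 M : R, 0 < M &
  forall q, rect x y (t * w) (t * h) q ->
  rect (- M) (- M) (M + M) (M + M) (F q))) => //.
  move=> x y t t_gt0 [M1 M1_gt0 h1] [M2 M2_gt0 h2].
  move=> [M3 M3_gt0 h3] [M4 M4_gt0 h4].
  have tw : t * w = t / 2 * w + t / 2 * w by field.
  have th : t * h = t / 2 * h + t / 2 * h by field.
  exists (M1 + M2 + M3 + M4); first by lra.
  rewrite tw th; move=> q /andP[qx qy].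
  have [q1|q1] := leP q.1 (x + t / 2 * w);
    have [q2|q2] := leP q.2 (y + t / 2 * h).
  - by apply: (@mono M1); [lra|]; apply: h1; apply/andP; split; lra.
  - by apply: (@mono M3); [lra|]; apply: h3; apply/andP; split; lra.
  - by apply: (@mono M2); [lra|]; apply: h2; apply/andP; split; lra.
  - by apply: (@mono M4); [lra|]; apply: h4; apply/andP; split; lra.
move=> p; have [d d_gt0 dF] := (continuous_sup_closeP F).1 cF p 1 ltr01.
pose D := w + h + 1; have D_gt0 : 0 < D by rewrite /D; lra.
exists (d / D); first by rewrite divr_gt0.
move=> x y t /andP[t_gt0]; rewrite ltr_pdivlMr// => tDd /andP[px py].
have tw0 : 0 <= t * w by rewrite mulr_ge0// ltW.
have th0 : 0 <= t * h by rewrite mulr_ge0// ltW.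
have tD : t * D = t * w + t * h + t by rewrite /D; ring.
have n1 := normr_ge0 (F p).1; have n2 := normr_ge0 (F p).2.
exists (`|(F p).1| + `|(F p).2| + 1); first by lra.
move=> q /andP[qx qy]; have [|] := dF q.
  by split; rewrite ltr_norml; apply/andP; split; lra.
rewrite !ltr_norml => /andP[F1 F2] /andP[F3 F4].
have := ler_norm (F p).1; have := ler_norm (- (F p).1).
have := ler_norm (F p).2; have := ler_norm (- (F p).2).
by rewrite !normrN => *; apply/andP; split; lra.
Qed.

(** Uniform continuity of [F'] near the compact image of the rectangle; only [q] is confined to the
    rectangle, while [q'] is arbitrary. *)
Lemma uniform_separation (R : realType) (F F' : R * R -> R * R)
    (x y w h r : R) :
  0 <= w -> 0 <= h -> continuous F -> continuous F' -> cancel F F' -> 0 < r ->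
  exists2 e : R, 0 < e & forall q q', rect x y w h q ->
    sup_close e (F q) (F q') -> sup_close r q q'.
Proof.
move=> w0 h0 cF cF' FK r_gt0.
suff H : forall x y t, 0 < t -> exists2 e : R, 0 < e &
    forall q q', rect x y (t * w) (t * h) q ->
    sup_close e (F q) (F q') -> sup_close r q q'.
  by have := H x y 1 ltr01; rewrite !mul1r.
have mono (a b : R) p q : a <= b -> sup_close a p q -> sup_close b p q.
  by move=> ab [p1 p2]; split; exact: lt_le_trans ab.
have tri (a b : R) p q z : sup_close a p q -> sup_close b q z ->
    sup_close (a + b) p z.
  move=> [p1 p2] [q1 q2]; split.
    have := ler_distD q.1 z.1 p.1; lra.
  have := ler_distD q.2 z.2 p.2; lra.
have sym (a : R) p q : sup_close a p q -> sup_close a q p.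
  by move=> [p1 p2]; split; rewrite distrC.
move=> {x y}; apply: (@rect_bisection R w h (fun x y t => exists2 e : R, 0 < e &
    forall q q', rect x y (t * w) (t * h) q ->
    sup_close e (F q) (F q') -> sup_close r q q')) => //.
  move=> x y t t_gt0 [e1 e1_gt0 h1] [e2 e2_gt0 h2].
  move=> [e3 e3_gt0 h3] [e4 e4_gt0 h4].
  have tw : t * w = t / 2 * w + t / 2 * w by field.
  have th : t * h = t / 2 * h + t / 2 * h by field.
  exists (Num.min (Num.min e1 e2) (Num.min e3 e4)).
    by rewrite !lt_min e1_gt0 e2_gt0 e3_gt0.
  rewrite tw th; move=> q q' /andP[qx qy] Fqq'.
  have [q1|q1] := leP q.1 (x + t / 2 * w);
    have [q2|q2] := leP q.2 (y + t / 2 * h).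
  - apply: h1; first by apply/andP; split; lra.
    by apply: mono Fqq'; rewrite !ge_min lexx.
  - apply: h3; first by apply/andP; split; lra.
    by apply: mono Fqq'; rewrite !ge_min lexx !orbT.
  - apply: h2; first by apply/andP; split; lra.
    by apply: mono Fqq'; rewrite !ge_min lexx !orbT.
  - apply: h4; first by apply/andP; split; lra.
    by apply: mono Fqq'; rewrite !ge_min lexx !orbT.
move=> p; have r2 : 0 < r / 2 by rewrite divr_gt0.
have [e e_gt0 eF'] := (continuous_sup_closeP F').1 cF' (F p) _ r2.
have e2 : 0 < e / 2 by rewrite divr_gt0.
have [d d_gt0 dF] := (continuous_sup_closeP F).1 cF p _ e2.
pose D := w + h + 1; have D_gt0 : 0 < D by rewrite /D; lra.
exists (Num.min d (r / 2) / D); first by rewrite divr_gt0// lt_min d_gt0.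
move=> x y t /andP[t_gt0].
rewrite ltr_pdivlMr// lt_min => /andP[tDd tDr] /andP[px py].
have tw0 : 0 <= t * w by rewrite mulr_ge0// ltW.
have th0 : 0 <= t * h by rewrite mulr_ge0// ltW.
have tD : t * D = t * w + t * h + t by rewrite /D; ring.
exists (e / 2) => // q q' /andP[qx qy] Fqq'.
have pq (a : R) : t * D < a -> sup_close a p q.
  by move=> tDa; split; rewrite ltr_norml; apply/andP; split; lra.
have := eF' (F q'); rewrite !FK => pq'.
rewrite [r](splitr r); apply: (tri _ _ _ _ _ (sym _ _ _ (pq _ tDr))).
apply: pq'; rewrite [e](splitr e).
exact: (tri _ _ _ _ _ (dF _ (pq _ tDd)) Fqq').
Qed.

(* The preimage under [G] of the segment from [G q] to [F q] starts at [q] and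
   cannot reach distance [k] from [q], so [F q] is the [G]-image of a point near
   [q]: this replaces the degree argument for [F (Q) <= G (Q')]. *)
Lemma limit_contracting (R : realType) (F F' : R * R -> R * R) :
  continuous F -> continuous F' -> cancel F F' -> cancel F' F ->
  (forall x y t e : R, 0 < t -> 0 < e ->
    exists G G', area_contracting_pair G G' /\
      (forall q, rect x y t t q -> sup_close e (F q) (G q))) ->
  contracting F /\ contracting F'.
Proof.
move=> cF cF' FK F'K approx; split=> x y w h w0 h0;
  apply: content_le_lim => e e_gt0;
  have [k k_gt0 ke] := rect_enlarge w0 h0 e_gt0;
  have wk : 0 <= w + 2 * k by lra.
all: have hk : 0 <= h + 2 * k by lra.
- have [d d_gt0 dF] := uniform_separation x y w0 h0 cF cF' FK k_gt0.
  have cid : continuous (@id (R * R)) by move=> p; exact: cvg_id.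
  (* Applied to the identity, this places the enlarged rectangle in a square, the shape that
     [approx] requires. *)
  have [M M_gt0 MP] := @image_bounded R id (x - k) (y - k) _ _ wk hk cid.
  have M2 : 0 < M + M by lra.
  have d2 : 0 < d / 2 by rewrite divr_gt0.
  have [G [G' [[[cG cG'] GK G'K kG kG'] FG]]] :=
    approx (- M) (- M) (M + M) (d / 2) M2 d2.
  have near_F q v : rect x y w h q -> `|v - q| <= k ->
      rect (x - k) (y - k) (w + 2 * k) (h + 2 * k) v.
    move=> /andP[qx qy]; rewrite prod_norm_max ge_max => /andP[].
    by rewrite !ler_norml /= => v1 v2; apply/andP; split; lra.
  apply: content_leW ke (kG (x - k) (y - k) _ _ wk hk).
  move=> _ [q qR <-]; exists (G' (F q)); last by rewrite G'K.
  apply: (near_F _ _ qR); rewrite leNgt; apply/negP => k_lt.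
  pose u s := `|G' (seg (G q) (F q) s) - q|.
  have cu : continuous u.
    move=> s; apply: cvg_norm; apply: cvgB; last exact: cvg_cst.
    exact: (continuous_after (@seg_continuous R (G q) (F q)) cG').
  have u0 : u 0 = 0 by rewrite /u seg0 GK subrr normr0.
  have u1 : k < u 1 by rewrite /u seg1.
  have [|||s] := @IVT R u 0 1 k.
  + exact: ler01.
  + exact: continuous_subspaceT.
  + by rewrite u0 ge_min le_max (ltW k_gt0) (ltW u1) orbT.
  rewrite in_itv/= => s01 us.
  pose v := G' (seg (G q) (F q) s); have vq : `|v - q| = k := us.
  have vQ : rect (x - k) (y - k) (w + 2 * k) (h + 2 * k) v.
    by apply: (near_F _ _ qR); rewrite vq.
  have qQ : rect (x - k) (y - k) (w + 2 * k) (h + 2 * k) q.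
    by apply: (near_F _ _ qR); rewrite subrr normr0 ltW.
  have [Fq1 Fq2] := FG _ (MP _ qQ); have [Fv1 Fv2] := FG _ (MP _ vQ).
  (* [F v] is within [d / 2] of a point of the segment, and the segment lies within [d / 2] of
     [F q]. *)
  have : sup_close k q v.
    apply: dF => //; move: Fv1 Fv2; rewrite /v G'K /seg/=.
    have seg_near (a b c : R) : `|a - b| < d / 2 ->
        `|a + s * (b - a) - c| < d / 2 -> `|c - b| < d.
      move=> ab ac; have sab : `|a + s * (b - a) - b| < d / 2.
        have -> : a + s * (b - a) - b = (1 - s) * (a - b) by ring.
        rewrite normrM ger0_norm ?subr_ge0; last by case/andP: s01.
        by apply: le_lt_trans ab; rewrite ler_piMl//; lra.
      move: sab ac; rewrite !ltr_norml => *; apply/andP; split; lra.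
    by move=> Fv1 Fv2; split; [exact: seg_near Fq1 Fv1|exact: seg_near Fq2 Fv2].
  move=> [v1 v2]; have : `|v - q| < k by rewrite prod_norm_max gt_max v1 v2.
  by rewrite vq ltxx.
- have [M M_gt0 MP] := image_bounded x y w0 h0 cF'.
  have M2 : 0 < M + M by lra.
  have [G [G' [[[cG cG'] GK G'K kG kG'] FG]]] :=
    approx (- M) (- M) (M + M) k M2 k_gt0.
  apply: content_leW ke (kG' (x - k) (y - k) _ _ wk hk).
  (* For the inverse the inclusion is direct: [G (F' q)] is within [k] of [F (F' q) = q]. *)
  move=> _ [q qR <-]; exists (G (F' q)); last by rewrite GK.
  have [] := FG _ (MP _ qR); rewrite F'K !ltr_norml.
  by case/andP: qR => *; apply/andP; split; lra.
Qed.

(** * Periodicity of lifts of exact symplectic homeomorphisms *)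

Lemma within_continuous_after (T U V : topologicalType) (D : set U)
    (c : T -> U) (f : U -> V) :
  continuous c -> (forall z, D (c z)) -> {within D, continuous f} ->
  continuous (f \o c).
Proof.
move=> cc cD /subspace_continuousP cf z W /(cf _ (cD z)) near_cz.
by apply: (@filterS _ (nbhs z) _ _ _ _ (cc z _ near_cz)) => z' /=; exact.
Qed.

(** Along a lift [U] of the homotopy restricted to the circle of height 0, the increment over one
    period is a continuous integer; it is 1 at time 0 and [k] at time 1. *)
Lemma homotopic_to_id_period (R : realType) (g : annulus R -> annulus R)
    (G : R * R -> R * R) :
  homotopic_to_id R g -> continuous G -> lifts G g ->
  forall p, G (p + (1, 0)) = G p + (1, 0).
Proof.
move=> [H [cH H0 H1]] cG Gg; have [k kZ Gk] := lifts_period cG Gg.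
(* Clamping the time extends the homotopy to the whole plane, where lifts are available. *)
pose c (z : R * R) : R * annulus R := (clamp 0 1 z.1, annulus_pi (z.2, 0)).
have cc : continuous c.
  apply: continuous_pair.
    exact: continuous_after (@continuous_fst _ _) (@clamp_continuous R 0 1).
  apply: (@continuous_after _ _ _ (fun z : R * R => (z.2, 0 : R))
    (@annulus_pi R)); last exact: annulus_pi_continuous.
  by apply: continuous_pair; [exact: continuous_snd|exact: cst_continuous].
have cD z : (`[0, 1]%classic `*` [set: annulus R]) (c z).
  by split => //=; rewrite in_itv/=; exact: clamp_itv ler01.
have cHc := within_continuous_after cc cD cH.
have [U [cU UH]] := lift_exists (continuous_after cHc (@continuous_fst _ _)).
have shift1 : continuous (fun z : R * R => (z.1, z.2 + 1)).
  apply: (@continuous_map_snd R (fun y => y + 1)) => y.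
  by apply: cvgD; [exact: cvg_id|exact: cvg_cst].
have Uper := @int_valued_constant R (fun z => U (z.1, z.2 + 1) - U z) _ _.
have {}Uper : U (0, 0 + 1) - U (0, 0) = U (1, 0 + 1) - U (1, 0).
  apply: (Uper _ _ (0, 0) (1, 0)).
    move=> z; apply: cvgB; last exact: cU.
    exact: (continuous_after shift1 cU).
  move=> z; apply/angle_eq; rewrite !UH /c /=.
  by congr (H (_, _)).1; apply/annulus_pi_eq; rewrite /= addrC addKr rpred1.
have slice (s : R) : continuous (fun z : R * R => U (s, z.1)).
  apply: (@continuous_after _ _ _ (fun z : R * R => (s, z.1)) U) => //.
  by apply: continuous_pair; [exact: cst_continuous|exact: continuous_fst].
have U0 := @int_valued_constant R (fun z => U (0, z.1) - z.1) _ _.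
have {}U0 : U (0, 0) - 0 = U (0, 1) - 1.
  apply: (U0 _ _ (0, 0) (1, 0)).
    by move=> z; apply: cvgB; [exact: slice|exact: continuous_fst].
  by move=> z; apply/angle_eq; rewrite UH /c/= clamp_id ?lexx ?ler01// H0.
have U1 := @int_valued_constant R (fun z => U (1, z.1) - (G (z.1, 0)).1) _ _.
have {}U1 : U (1, 0) - (G (0, 0)).1 = U (1, 1) - (G (1, 0)).1.
  apply: (U1 _ _ (0, 0) (1, 0)).
    move=> z; apply: cvgB; first exact: slice.
    apply: (@continuous_after _ _ _ (fun z : R * R => (z.1, 0 : R))
      (fun p => (G p).1)).
      by apply: continuous_pair; [exact: continuous_fst|exact: cst_continuous].
    exact: continuous_after cG (@continuous_fst _ _).
  move=> z; apply/angle_eq; rewrite UH /c/= clamp_id ?lexx ?ler01// H1.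
  by rewrite -Gg.
have Gk1 := congr1 fst (Gk (0, 0)); rewrite /= in Gk1.
have e10 : (0, 0) + (1, 0) = (1, 0) :> R * R by congr pair; rewrite /= add0r.
suff k1 : k = 1 by move=> p; rewrite Gk k1.
by move: Gk1 Uper; rewrite e10 /= add0r; lra.
Qed.

Lemma exact_diffeomorphism_lift (R : realType) (g : annulus R -> annulus R) :
  exact_symplectic_diffeomorphism g ->
  exists G G', lifts G g /\ area_contracting_pair G G'.
Proof.
move=> [gdiff _ gexact]; apply: diffeomorphism_contracting => // G Gg C1G.
have [S [C1S SG]] := gexact G Gg C1G; exact: exact_det1 C1S SG.
Qed.

Lemma symplectic_diffeomorphism_lift (R : realType)
    (g : annulus R -> annulus R) :
  symplectic_diffeomorphism g ->
  exists G G', lifts G g /\ area_contracting_pair G G'.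
Proof.
move=> [gdiff gsymp]; apply: diffeomorphism_contracting => // G Gg C1G p.
by rewrite gsymp// /area_form/= mulr1 mul0r subr0.
Qed.

Lemma homeomorphism_lift (R : realType) (f f' : annulus R -> annulus R) :
  homeomorphism f -> cancel f f' -> cancel f' f ->
  exists F F', [/\ continuous F /\ continuous F', lifts F f, lifts F' f',
    cancel F F' & cancel F' F].
Proof.
move=> [cf [h [fh hf ch]]] ff' f'f.
have cf' : continuous f'.
  suff -> : f' = h by [].
  by apply/funext => z; rewrite -[z in LHS]hf ff'.
have [F [cF Ff]] := lift_map cf; have [F' [cF' F'f']] := lift_map cf'.
have [k [kZ FK F'K]] := lifts_inverse ff' f'f cF cF' Ff F'f'.
exists F, (fun p => F' (p + (k, 0))); split => //.
  split => //.
  exact: continuous_after (@translation_continuous R (k, 0)) cF'.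
by move=> p; rewrite F'f' annulus_pi_int.
Qed.

(** An approximating lift of period 1 is within 1/2 of [F] at both [(0, 0)] and [(1, 0)], so
    [|k - 1| < 1]. *)
Lemma exact_homeomorphism_period (R : realType) (f : annulus R -> annulus R)
    (F : R * R -> R * R) :
  exact_symplectic_homeomorphism f -> continuous F -> lifts F f ->
  forall p, F (p + (1, 0)) = F p + (1, 0).
Proof.
move=> [_ flim] cF Ff; have [k kZ Fk] := lifts_period cF Ff.
have h2 : 0 < 1 / 2 :> R by lra.
have [g [G [G' [[_ gid _] Gg [[cG _] _ _ _ _] FG]]]] :=
  approx_lift 0 0 (@exact_diffeomorphism_lift R) flim cF Ff (@ltr01 R) h2.
have G1 := homotopic_to_id_period gid cG Gg (0, 0).
have F1 := Fk (0, 0).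
have e10 : (0, 0) + (1, 0) = (1, 0) :> R * R by congr pair; rewrite /= add0r.
have [|a0 _] := FG (0, 0); first by rewrite /rect/= !add0r lexx ler01.
have [|a1 _] := FG (1, 0); first by rewrite /rect/= !add0r !lexx ler01.
rewrite -e10 G1 F1 /= in a1.
suff k1 : k = 1 by move=> p; rewrite Fk k1.
apply/eqP; rewrite -subr_eq0; apply: contraT => k1.
have : 1 <= `|k - 1| by apply: norm_intr_ge1 => //; rewrite rpredB// rpred1.
move: a0 a1; rewrite !ltr_norml => /andP[a01 a02] /andP[a11 a12].
by rewrite leNgt ltr_norml => /negP[]; apply/andP; split; lra.
Qed.

(** * Conclusion *)

Lemma period_int (R : realType) (F : R * R -> R * R) (k n : R) :
  (forall p, F (p + (1, 0)) = F p + (k, 0)) -> n \is a Num.int ->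
  forall p, F (p + (n, 0)) = F p + (n * k, 0).
Proof.
move=> Fk; have pairD (a b : R) : (a + b, 0) = (a, 0) + (b, 0) :> R * R.
  by congr pair; rewrite /= addr0.
have Fnat (m : nat) p : F (p + (m%:R, 0)) = F p + (m%:R * k, 0).
  elim: m => [|m IH]; first by rewrite mul0r !addr0.
  by rewrite -natr1 pairD addrA Fk IH mulrDl mul1r pairD addrA.
move=> /intrP[[m|m] ->] p; first exact: Fnat.
rewrite NegzE mulrNz mulNr.
apply: (addIr (m.+1%:R * k, 0)); rewrite -[RHS]addrA -pairD addNr addr0.
by rewrite -Fnat -addrA -pairD addNr addr0.
Qed.

Lemma contracting_fiberwise (R : realType) (G : R * R -> R * R) (a b r : R) :
  continuous G -> contracting G -> (forall p, (G p).2 = p.2) -> a <= b ->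
  (G (b, r)).1 - (G (a, r)).1 <= b - a.
Proof.
move=> cG kG G2 ab; apply/ler_addgt0Pr => e e_gt0.
have e2 : 0 < e / 2 by rewrite divr_gt0.
have [d1 d1_gt0 d1P] := (continuous_sup_closeP G).1 cG (a, r) _ e2.
have [d2 d2_gt0 d2P] := (continuous_sup_closeP G).1 cG (b, r) _ e2.
pose h := Num.min d1 d2 / 2.
have m_gt0 : 0 < Num.min d1 d2 by rewrite lt_min d1_gt0.
have h_gt0 : 0 < h by rewrite divr_gt0.
have /andP[hd1 hd2] : (h < d1) && (h < d2) by rewrite -lt_min /h; lra.
(* A length [e / 2] is given up at each end, so that an interval of width [W] is covered at every
   height between [r] and [r + h]. *)
pose W := (G (b, r)).1 - (G (a, r)).1 - e.
have [W0|/ltW W0] := leP W 0; first by rewrite /W in W0; lra.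
suff : W * h <= (b - a) * h by rewrite ler_pM2r// /W; lra.
have ba : 0 <= b - a by rewrite subr_ge0.
apply: (@content_le_rect_le R ((G (a, r)).1 + e / 2) r) => //; first exact: ltW.
apply: content_leW (kG a r _ _ ba (ltW h_gt0)) => // z /andP[zx zr].
have near_r d : h < d -> `|z.2 - r| < d.
  by move=> hd; rewrite ltr_norml; apply/andP; split; lra.
have [|+ _] := d1P (a, z.2).
  by split; rewrite /= ?subrr ?normr0//; exact: near_r.
have [|+ _] := d2P (b, z.2).
  by split; rewrite /= ?subrr ?normr0//; exact: near_r.
rewrite !ltr_norml => /andP[b1 b2] /andP[a1 a2].
have cX : continuous (fun s => (G (s, z.2)).1).
  apply: (@continuous_after _ _ _ (fun s : R => (s, z.2)) (fun p => (G p).1)).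
    apply: continuous_pair => [s|]; [exact: cvg_id|exact: cst_continuous].
  exact: continuous_after cG (@continuous_fst _ _).
have [||s] := @IVT R (fun s => (G (s, z.2)).1) a b z.1 ab.
- exact: continuous_subspaceT.
- rewrite /W in zx; rewrite ge_min le_max.
  by apply/andP; split; apply/orP; [left|right]; lra.
rewrite in_itv/= => sab Gs; exists (s, z.2).
  by apply/andP; split => //=; lra.
by rewrite [LHS]surjective_pairing Gs G2 -surjective_pairing.
Qed.

Lemma fiberwise_translation (R : realType) (G : R * R -> R * R) (x r : R) :
  continuous G -> contracting G -> (forall p, (G p).2 = p.2) ->
  (forall p, G (p + (1, 0)) = G p + (1, 0)) ->
  (G (x, r)).1 = x + (G (0, r)).1.
Proof.
move=> cG kG G2 G1.
have main a b : a <= b -> (G (b, r)).1 - (G (a, r)).1 = b - a.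
  move=> ab; apply/le_anti/andP; split; first exact: contracting_fiberwise.
  (* The complementary arc is [[b, a + n]], with enough turns for [a + n] to lie beyond [b]. *)
  pose n : R := (Num.truncn (b - a)).+1%:R.
  have ban : b <= a + n by rewrite -lerBlDl ltW// truncnS_gt.
  have := contracting_fiberwise r cG kG G2 ban.
  have -> : (a + n, r) = (a, r) + (n, 0) by congr pair; rewrite /= addr0.
  by rewrite (period_int G1) ?natr_int//= mulr1; lra.
have [x0|/ltW x0] := leP 0 x; first by have := main _ _ x0; lra.
by have := main _ _ x0; lra.
Qed.

Theorem proposition1p1 (R : realType) (f : annulus R -> annulus R)
    (F : set (set (annulus R))) (Phi Phi_inv : annulus R -> annulus R)
    (f_exact : exact_symplectic_homeomorphism f)
    (F_graphs : C0_graph_foliation F)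
    (f_leaves : forall L, F L -> f @` L = L)
    (Phi_symp : symplectic_homeomorphism Phi)
    (PhiK : cancel Phi Phi_inv)
    (Phi_invK : cancel Phi_inv Phi)
    (Phi_F : [set Phi @` L | L in F] = standard_foliation R) :
  exists rho : R -> R, continuous rho /\
    forall (theta : circle R) (r : R),
      Phi (f (Phi_inv (theta, r))) = (theta + angle (rho r), r).
Proof.
have [f_homeo f_lim] := f_exact; have [Phi_homeo Phi_lim] := Phi_symp.
have [_ [f_inv [fK f_invK _]]] := f_homeo.
have [A [A' [[cA cA'] Af A'f AK A'K]]] := homeomorphism_lift f_homeo fK f_invK.
have [B [B' [[cB cB'] BPhi B'Phi BK B'K]]] :=
  homeomorphism_lift Phi_homeo PhiK Phi_invK.
have kA : contracting A.
  apply: (limit_contracting cA cA' AK A'K _).1 => x y t e t_gt0 e_gt0.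
  have [g [G [G' [_ _ GG' AG]]]] :=
    approx_lift x y (@exact_diffeomorphism_lift R) f_lim cA Af t_gt0 e_gt0.
  by exists G, G'.
have [kB kB'] : contracting B /\ contracting B'.
  apply: (limit_contracting cB cB' BK B'K) => x y t e t_gt0 e_gt0.
  have [g [G [G' [_ _ GG' BG]]]] := approx_lift x y
    (@symplectic_diffeomorphism_lift R) Phi_lim cB BPhi t_gt0 e_gt0.
  by exists G, G'.
pose G := B \o A \o B'.
have cG : continuous G := continuous_after cB' (continuous_after cA cB).
have kG : contracting G := contracting_comp (contracting_comp kB kA) kB'.
have Gg p : annulus_pi (G p) = Phi (f (Phi_inv (annulus_pi p))).
  by rewrite /G /= BPhi Af B'Phi.
(* The leaf of [F] that [Phi] sends onto the circle of height [p.2] is invariant under [f]. *)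
have G2 p : (G p).2 = p.2.
  have : standard_foliation R [set q | q.2 = p.2] by exists p.2.
  rewrite -Phi_F => -[L FL PhiL].
  have : (Phi @` L) (annulus_pi p) by rewrite PhiL.
  move=> [y Ly Phiy]; have := Gg p; rewrite -Phiy PhiK => Gy.
  have : (Phi @` L) (Phi (f y)).
    by exists (f y) => //; rewrite -(f_leaves _ FL); exists y.
  by rewrite PhiL -Gy.
have G1 p : G (p + (1, 0)) = G p + (1, 0).
  have A1 := exact_homeomorphism_period f_exact cA Af.
  have [k kZ Bk] := lifts_period cB BPhi.
  have [k' k'Z B'k'] := lifts_period cB' B'Phi.
  (* [Phi] may reverse the direction of the circle, with [k = k' = -1]; the two signs cancel in the
     conjugate. *)
  have k'k : k' * k = 1.
    have := B'K ((0, 0) + (1, 0)).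
    rewrite B'k' (period_int Bk k'Z) B'K => /(congr1 fst) /=.
    by rewrite !add0r.
  by rewrite /G /= B'k' (period_int A1 k'Z) mulr1 (period_int Bk k'Z) k'k.
exists (fun r => (G (0, r)).1); split.
  apply: (@continuous_after _ _ _ (fun r : R => (0 : R, r)) (fun p => (G p).1)).
    by apply: continuous_pair => [|r]; [exact: cst_continuous|exact: cvg_id].
  exact: continuous_after cG (@continuous_fst _ _).
move=> theta r; have [x <-] := angle_surj theta.
rewrite -[(angle x, r)]/(annulus_pi (x, r)) -Gg /annulus_pi G2 /=.
by rewrite (fiberwise_translation x r cG kG G2 G1) angleD.
Qed.
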